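(* Let $(\Omega,\mathcal H,\overline{\mathbf E})$ be a sublinear expectation space and let $X_1,X_2,\dots$ be random variables that are i.i.d. with $X_0$ under $\overline{\mathbf E}$, where $X_0,X_0^2\in\mathcal H$ and $0<\underline\sigma\le\overline\sigma<\infty$. Let $n\ge1$ be an integer and let $Z\sim N(0,1)$ be a classical standard normal random variable. Then the Prokhorov distance $\overline\pi(W_{n,n},Z)$ under the sublinear expectation satisfies $$\overline\pi(W_{n,n},Z)\le\frac{\sqrt{C_5\,\gamma_3}}{n^{1/4}},\qquad C_5=12.$$
   Context: Sublinear expectation space: $\mathcal H$ is a linear space of real-valued random variables on $\Omega$ containing the constants, and $\overline{\mathbf E}:\mathcal H\to\mathbb R$ satisfies for $X,Y\in\mathcal H$: (i) $\overline{\mathbf E}[X]\le\overline{\mathbf E}[Y]$ if $X\le Y$; (ii) $\overline{\mathbf E}[c]=c$ for constants $c$; (iii) $\overline{\mathbf E}[X+Y]\le\overline{\mathbf E}[X]+\overline{\mathbf E}[Y]$; (iv) $\overline{\mathbf E}[\lambda X]=\lambda\overline{\mathbf E}[X]$ for constants $\lambda\ge0$. Put $\underline{\mathbf E}[X]:=-\overline{\mathbf E}[-X]$. Independence: a random vector $\vec Y\in\mathbb R^l$ is independent to $\vec X\in\mathbb R^m$ if for all bounded continuous $\psi:\mathbb R^{l+m}\to\mathbb R$ one has $\psi(\vec X,\vec Y)\in\mathcal H$ and $\overline{\mathbf E}[\psi(\vec X,\vec Y)]=\overline{\mathbf E}\big[\overline{\mathbf E}[\psi(\vec x,\vec Y)]|_{\vec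 x=\vec X}\big]$. The sequence $X_1,X_2,\dots$ is i.i.d. with $X_0$ if for each $k\ge2$, $X_k$ is independent to $\vec X_{k-1}=(X_1,\dots,X_{k-1})$, and for every $k\ge1$, $\overline{\mathbf E}[\psi(X_k)]=\overline{\mathbf E}[\psi(X_0)]$ for every bounded continuous $\psi:\mathbb R\to\mathbb R$. In particular $\psi(\vec X_k)\in\mathcal H$ for all bounded continuous $\psi:\mathbb R^k\to\mathbb R$. Parameters: $\underline\mu=\underline{\mathbf E}[X_0]\le\overline\mu=\overline{\mathbf E}[X_0]$; for $\mu\in[\underline\mu,\overline\mu]$, $\underline\sigma^2(\mu)=\underline{\mathbf E}[(X_0-\mu)^2]$, $\overline\sigma^2(\mu)=\overline{\mathbf E}[(X_0-\mu)^2]$ (with nonnegative square roots $\underline\sigma(\mu),\overline\sigma(\mu)$); $\underline\sigma=\inf_{\mu\in[\underline\mu,\overline\mu]}\underline\sigma(\mu)$, $\overline\sigma=\sup_{\mu\in[\underline\mu,\overline\mu]}\overline\sigma(\mu)$. Extended expectation: for any $\phi:\mathbb R\to\mathbb R$, $\overline{\mathbf E}[\phi(X_0)]:=\inf\{\overline{\mathbf E}[X]: X\ge\phi(X_0),\ X\in\mathcal H\}\le\infty$, with $\inf\emptyset=\infty$. With $\xi_0(\mu):=(X_0-\mu)/\underline\sigma(\mu)$, $\gamma_3:=\sup_{\mu\in[\underline\mu,\overline\mu]}\overline{\mathbf E}[|\xi_0(\mu)|^3]\le\infty$ (the bound is trivial if $\gamma_3=\infty$). Normalized sums: $W_{0,n}=0$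 and $W_{k,n}:=\frac1{\sqrt n}\sum_{i=1}^k\frac{X_i-\mu_i}{\sigma_i}$, $k=1,\dots,n$. $\mathcal A_n$ is the set of all sequences $\{(\mu_i,\sigma_i)\}_{i=1}^n$ such that for each $i$, $\mu_i$ and $\sigma_i$ are (one-dimensional) continuous functions of $W_{i-1,n}$ (so the sums are built recursively) with $\underline\mu\le\mu_i\le\overline\mu$ and $\underline\sigma\le\underline\sigma(\mu_i)\le\sigma_i\le\overline\sigma(\mu_i)\le\overline\sigma$. Upper probability: $\overline{\mathbf P}(W_{n,n}\in A):=\inf\{\overline{\mathbf E}\psi(\vec X_n):\ \psi(\vec X_n)\ge \mathbf I(W_{n,n}\in A),\ \psi(\vec X_n)\in\mathcal H\}$, $\mathbf I$ denoting the indicator. $A^\varepsilon=\{x\in\mathbb R:\exists y\in A,\ |x-y|<\varepsilon\}$. Prokhorov distance under the sublinear expectation: for arbitrary (not necessarily measurable) $A\subset\mathbb R$ and $\varepsilon>0$ let $$\overline\delta_n(A,\varepsilon):=\inf_{\{(\mu_i,\sigma_i)\}\in\mathcal A_n}\overline{\mathbf P}(W_{n,n}\in A)-\mathbf P(Z\in A^\varepsilon),\qquad \overline\pi(W_{n,n},Z):=\inf\Big\{\varepsilon>0:\sup_{A\subset\mathbb R}\overline\delta_n(A,\varepsilon)\le\varepsilon\Big\}.$$ *)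

(* Defs.v *)
From HB Require Import structures.
From mathcomp Require Import all_boot all_order all_algebra.
From mathcomp Require Import all_classical all_reals all_analysis.

Set Implicit Arguments.
Unset Strict Implicit.
Unset Printing Implicit Defensive.

Import Order.TTheory GRing.Theory Num.Theory.
Import numFieldTopology.Exports numFieldNormedType.Exports.

Local Open Scope classical_set_scope.
Local Open Scope ring_scope.

(* [upexp] is a total function, but only its values on [rvs] (the space H) are
   constrained.  Hence, below, every equation between upper expectations that
   is part of a hypothesis is stated together with the membership in [rvs] of
   its arguments. *)
Record sublinear_space (R : realType) (Omega : Type) := SublinearSpace {
  rvs : set (Omega -> R);
  upexp : (Omega -> R) -> R;
  rvs_cst : forall c : R, rvs (fun=> c);
  rvsD : forall X Y, rvs X -> rvs Y -> rvs (fun w => X w + Y w);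
  rvsZ : forall (c : R) X, rvs X -> rvs (fun w => c * X w);
  upexp_mono : forall X Y, rvs X -> rvs Y ->
    (forall w, X w <= Y w) -> upexp X <= upexp Y;
  upexp_cst : forall c : R, upexp (fun=> c) = c;
  upexp_subadd : forall X Y, rvs X -> rvs Y ->
    upexp (fun w => X w + Y w) <= upexp X + upexp Y;
  upexp_homog : forall (c : R) X, 0 <= c -> rvs X ->
    upexp (fun w => c * X w) = c * upexp X }.

Definition lowexp (R : realType) (Omega : Type) (S : sublinear_space R Omega)
    (X : Omega -> R) : R := - upexp S (fun w => - X w).

(* The extension of the upper expectation to arbitrary functions; the infimum
   of the empty set is +oo. *)
Definition upexp_ext (R : realType) (Omega : Type) (S : sublinear_space R Omega)
    (Y : Omega -> R) : \bar R :=
  ereal_inf [set (upexp S X)%:E | X in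
               [set X | rvs S X /\ forall w, Y w <= X w]].

Definition bounded_continuous (R : realType) (T : topologicalType)
    (psi : T -> R) : Prop := bounded_fun psi /\ continuous psi.

(* [Y] is independent to [X] (an asymmetric relation).  That [psi (x, Y)] is in
   [rvs] for each fixed [x] is the first clause applied to the function
   [(x', y) |-> psi (x, y)]. *)
Definition independent_to (R : realType) (Omega : Type)
    (S : sublinear_space R Omega) (m l : nat)
    (Y : Omega -> 'rV[R]_l) (X : Omega -> 'rV[R]_m) : Prop :=
  forall psi : 'rV[R]_(m + l) -> R, bounded_continuous psi ->
    let inner (x : 'rV[R]_m) := upexp S (fun w => psi (row_mx x (Y w))) in
    [/\ rvs S (fun w => psi (row_mx (X w) (Y w))),
        rvs S (fun w => inner (X w)) &
        upexp S (fun w => psi (row_mx (X w) (Y w))) =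
        upexp S (fun w => inner (X w))].

Definition same_distribution (R : realType) (Omega : Type)
    (S : sublinear_space R Omega) (X Y : Omega -> R) : Prop :=
  forall psi : R -> R, bounded_continuous psi ->
    [/\ rvs S (psi \o X), rvs S (psi \o Y) &
        upexp S (psi \o X) = upexp S (psi \o Y)].

(* The vector (X_1, ..., X_k); [X 0] is the reference variable X_0 and is not
   one of its components. *)
Definition Xvec (R : realType) (Omega : Type) (X : nat -> Omega -> R) (k : nat)
    (w : Omega) : 'rV[R]_k := \row_(i < k) X i.+1 w.

Definition iid_with_X0 (R : realType) (Omega : Type)
    (S : sublinear_space R Omega) (X : nat -> Omega -> R) : Prop :=
  (forall k, (2 <= k)%N ->
     independent_to S (fun w => \row_(_ < 1) X k w) (Xvec X k.-1)) /\
  (forall k, (1 <= k)%N -> same_distribution S (X k) (X 0%N)).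

Definition low_mean (R : realType) (Omega : Type) (S : sublinear_space R Omega)
    (X0 : Omega -> R) : R := lowexp S X0.

Definition up_mean (R : realType) (Omega : Type) (S : sublinear_space R Omega)
    (X0 : Omega -> R) : R := upexp S X0.

Definition mean_interval (R : realType) (Omega : Type)
    (S : sublinear_space R Omega) (X0 : Omega -> R) : set R :=
  [set mu | low_mean S X0 <= mu <= up_mean S X0].

Definition low_sd_at (R : realType) (Omega : Type) (S : sublinear_space R Omega)
    (X0 : Omega -> R) (mu : R) : R :=
  Num.sqrt (lowexp S (fun w => (X0 w - mu) ^+ 2)).

Definition up_sd_at (R : realType) (Omega : Type) (S : sublinear_space R Omega)
    (X0 : Omega -> R) (mu : R) : R :=
  Num.sqrt (upexp S (fun w => (X0 w - mu) ^+ 2)).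

Definition low_sd (R : realType) (Omega : Type) (S : sublinear_space R Omega)
    (X0 : Omega -> R) : \bar R :=
  ereal_inf [set (low_sd_at S X0 mu)%:E | mu in mean_interval S X0].

Definition up_sd (R : realType) (Omega : Type) (S : sublinear_space R Omega)
    (X0 : Omega -> R) : \bar R :=
  ereal_sup [set (up_sd_at S X0 mu)%:E | mu in mean_interval S X0].

Definition gamma3 (R : realType) (Omega : Type) (S : sublinear_space R Omega)
    (X0 : Omega -> R) : \bar R :=
  ereal_sup [set upexp_ext S
                   (fun w => `|(X0 w - mu) / low_sd_at S X0 mu| ^+ 3)
            | mu in mean_interval S X0].

(* W_{k,n}; the random variables [mu i] and [sg i] are used for 1 <= i <= k. *)
Definition Wsum (R : realType) (Omega : Type) (X mu sg : nat -> Omega -> R)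
    (n k : nat) (w : Omega) : R :=
  (Num.sqrt n%:R)^-1 * \sum_(1 <= i < k.+1) ((X i w - mu i w) / sg i w).

(* The class A_n.  The condition on index [i] only involves the indices smaller
   than [i] through W_{i-1,n}; entries outside 1..n are irrelevant. *)
Definition controls (R : realType) (Omega : Type) (S : sublinear_space R Omega)
    (X : nat -> Omega -> R) (n : nat) :
    set ((nat -> Omega -> R) * (nat -> Omega -> R)) :=
  [set c | forall i, (1 <= i <= n)%N ->
    [/\ (exists2 f : R -> R, continuous f &
           forall w, c.1 i w = f (Wsum X c.1 c.2 n i.-1 w)),
        (exists2 g : R -> R, continuous g &
           forall w, c.2 i w = g (Wsum X c.1 c.2 n i.-1 w)),
        (forall w, low_mean S (X 0%N) <= c.1 i w <= up_mean S (X 0%N)) &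
        (forall w,
           [/\ (low_sd S (X 0%N) <= (low_sd_at S (X 0%N) (c.1 i w))%:E)%E,
               low_sd_at S (X 0%N) (c.1 i w) <= c.2 i w,
               c.2 i w <= up_sd_at S (X 0%N) (c.1 i w) &
               ((up_sd_at S (X 0%N) (c.1 i w))%:E <= up_sd S (X 0%N))%E])]].

Definition upper_prob (R : realType) (Omega : Type)
    (S : sublinear_space R Omega) (X : nat -> Omega -> R) (n : nat)
    (W : Omega -> R) (A : set R) : \bar R :=
  ereal_inf [set (upexp S (psi \o Xvec X n))%:E | psi in
    [set psi : 'rV[R]_n -> R |
       (forall w, \1_A (W w) <= psi (Xvec X n w)) /\
       rvs S (psi \o Xvec X n)]].

Definition enlargement (R : realType) (A : set R) (eps : R) : set R :=
  [set x | exists2 y, A y & `|x - y| < eps].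

Definition prokhorov_gap (R : realType) (Omega : Type)
    (S : sublinear_space R Omega) (X : nat -> Omega -> R) (n : nat)
    (d : measure_display) (T : measurableType d) (P : probability T R)
    (Z : {RV P >-> R}) (A : set R) (eps : R) : \bar R :=
  (ereal_inf [set upper_prob S X n (Wsum X c.1 c.2 n n) A
             | c in controls S X n]
   - P (Z @^-1` enlargement A eps))%E.

Definition prokhorov_dist (R : realType) (Omega : Type)
    (S : sublinear_space R Omega) (X : nat -> Omega -> R) (n : nat)
    (d : measure_display) (T : measurableType d) (P : probability T R)
    (Z : {RV P >-> R}) : \bar R :=
  ereal_inf [set eps%:E | eps in
    [set eps : R | 0 < eps /\
       (ereal_sup [set prokhorov_gap S X n Z A eps | A in [set: set R]]
          <= eps%:E)%E]].

Definition C5 (R : realType) : R := 12%:R.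

(* Main.v *)
Require Import Defs.
From HB Require Import structures.
From mathcomp Require Import all_boot all_order all_algebra.
From mathcomp Require Import all_classical all_reals all_analysis.
From mathcomp Require Import measurable_realfun ring lra.

Import Order.TTheory GRing.Theory Num.Theory.
Import numFieldTopology.Exports numFieldNormedType.Exports.

Local Open Scope classical_set_scope.
Local Open Scope ring_scope.

(** Lindeberg's method, run backwards with a controlled walk.  Replace the
    indicator of A by a C^2 cutoff u with values in [0, 1], equal to 1 on A,
    vanishing off A^e, and with u'' Lipschitz of constant 108 / e^3.  Let v_j be
    the average of u against N(0, j/n).  At step i, with j = n - i steps
    remaining, put p = v_j'(W_(i-1)) and q = v_j''(W_(i-1)).  The linear term of
    the Taylor expansion has nonpositive upper expectation if mu is the upper
    mean where p >= 0 and the lower mean where p <= 0; the quadratic term is at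
    most its Gaussian value if sigma is the upper standard deviation at mu where
    q >= 0 and the lower one where q <= 0.  Near p = 0 and q = 0 the controls are
    interpolated, which keeps them continuous at an arbitrarily small cost.  One
    step then costs |v_j^(3)| gamma_3 n^(-3/2) up to a constant, and |v_j^(3)| is
    at most 108 / e^3 and at most 49/40 (j/n)^(-3/2), because 0 <= u <= 1.  Using
    the first bound for j/n <= e^2/16 and the second one otherwise, the sum over
    j is of order n / e, without a logarithm, so that the total error is of order
    gamma_3 / (e sqrt n), which is below e once e^2 = 12 gamma_3 / sqrt n. *)

Set Implicit Arguments.
Unset Strict Implicit.
Unset Printing Implicit Defensive.

(** * Taylor expansion and smooth cutoffs *)

Section calculus.
Context {R : realType}.

(** This inequality is linear in the triple [u], [p], [q], hence stable under averaging over
    translates. The walk uses [p] and [q] only through it. *)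
Definition taylor3 (L : R) (u p q : R -> R) : Prop := forall x h,
  `|u (x + h) - u x - p x * h - q x * h ^+ 2 / 2| <= L / 6 * `|h| ^+ 3.

Lemma is_derive_continuous (f df : R -> R) :
  (forall x : R, is_derive x 1 f (df x)) -> continuous f.
Proof.
move=> fd x; apply/differentiable_continuous/derivable1_diffP.
exact: ex_derive.
Qed.

Lemma nonpos_of_derive (f df : R -> R) (t : R) : 0 <= t -> f 0 <= 0 ->
  (forall x : R, is_derive x 1 f (df x)) -> (forall x, 0 <= x -> df x <= 0) ->
  f t <= 0.
Proof.
rewrite le_eqVlt => /predU1P[<-//|t0] f0 fd df0.
have cf : {within `[0, t], continuous f}.
  by apply: continuous_subspaceT; exact: is_derive_continuous fd.
have [c ct] := MVT t0 (fun x _ => fd x) cf.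
rewrite subr0 => e.
have : df c * t <= 0.
  apply: mulr_le0_ge0; last exact: ltW.
  by apply: df0; move: ct; rewrite in_itv/= => /andP[/ltW].
lra.
Qed.

Lemma lipschitz_of_derive (f df : R -> R) (L : R) :
  (forall x : R, is_derive x 1 f (df x)) -> (forall x, `|df x| <= L) ->
  forall x y, `|f x - f y| <= L * `|x - y|.
Proof.
move=> fd dL x y.
wlog xy : x y / y <= x.
  move=> H; have [/H//|/ltW/H] := leP y x.
  by rewrite distrC (distrC y).
have cf : {within `[y, x], continuous f}.
  by apply: continuous_subspaceT; exact: is_derive_continuous fd.
have [c _ ->] := MVT_segment xy (fun x _ => fd x) cf.
by rewrite normrM ler_wpM2r.
Qed.

Lemma is_derive_comp_affine (f df : R -> R) (a b : R) :
  (forall x : R, is_derive x 1 f (df x)) ->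
  forall x : R, is_derive x 1 (fun t => f (a + b * t)) (b * df (a + b * x)).
Proof.
move=> fd x.
have h : is_derive x 1 (fun t : R => a + b * t) b.
  by apply: is_derive_eq; rewrite /GRing.scale /=; ring.
have := @is_derive1_comp _ f (fun t : R => a + b * t) x _ _ (fd _) h.
by rewrite mulrC.
Qed.

(** The sign [b] turns both directions of displacement into a time [t >= 0]. The defect [f1] has
    derivative [f2], both vanish at 0, and the Lipschitz bound on [q] makes first [f2], then [f1],
    nonincreasing. *)
Lemma taylor3_ub (L : R) (u p q : R -> R) (x b t : R) : b ^+ 2 = 1 -> 0 <= t ->
  (forall x : R, is_derive x 1 u (p x)) -> (forall x : R, is_derive x 1 p (q x)) ->
  (forall x y, `|q x - q y| <= L * `|x - y|) ->
  u (x + b * t) - u x - p x * (b * t) - q x * t ^+ 2 / 2 <= L / 6 * t ^+ 3.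
Proof.
move=> b1 t0 up pq qL.
have nb : `|b| = 1.
  by apply/eqP; rewrite -(@eqrXn2 _ 2)// -normrX b1 normr1 expr1n.
pose f2 s := b * p (x + b * s) - b * p x - q x * s - L / 2 * s ^+ 2.
pose f1 s := u (x + b * s) - u x - p x * (b * s) - q x * s ^+ 2 / 2
             - L / 6 * s ^+ 3.
have d2 (s : R) : is_derive s 1 f2 (q (x + b * s) - q x - L * s).
  have := is_derive_comp_affine x b pq s => ?.
  rewrite /f2; apply: is_derive_eq.
  rewrite /GRing.scale /=.
  transitivity (b ^+ 2 * q (x + b * s) - q x - L * s); last by rewrite b1 mul1r.
  by field.
have d1 (s : R) : is_derive s 1 f1 (f2 s).
  have := is_derive_comp_affine x b up s => ?.
  rewrite /f1 /f2; apply: is_derive_eq.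
  rewrite /GRing.scale /=; by field.
have f20 s : 0 <= s -> f2 s <= 0.
  move=> s0; apply: (nonpos_of_derive s0 _ d2).
    by rewrite /f2 mulr0 addr0; lra.
  move=> r r0.
  have := qL (x + b * r) x; rewrite addrAC subrr add0r normrM nb mul1r ger0_norm//.
  move/ler_normlP => []; lra.
have : f1 t <= 0.
  apply: (nonpos_of_derive t0 _ d1) => //.
  by rewrite /f1 mulr0 addr0; lra.
rewrite /f1; lra.
Qed.

Lemma taylor3_of_derive (L : R) (u p q : R -> R) :
  (forall x : R, is_derive x 1 u (p x)) -> (forall x : R, is_derive x 1 p (q x)) ->
  (forall x y, `|q x - q y| <= L * `|x - y|) -> taylor3 L u p q.
Proof.
move=> up pq qL x h.
(* The lower half of the estimate is the upper half for [- u]. *)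
have upN (y : R) : is_derive y 1 (fun z => - u z) (- p y) by exact: is_deriveN.
have pqN (y : R) : is_derive y 1 (fun z => - p z) (- q y) by exact: is_deriveN.
have qLN y z : `|- q y - - q z| <= L * `|y - z|.
  by rewrite -opprD normrN.
have [b [t [b1 t0 hE]]] : exists b t, [/\ b ^+ 2 = 1, 0 <= t & h = b * t].
  have [h0|/ltW h0] := leP 0 h.
    by exists 1, h; rewrite expr1n mul1r.
  by exists (- 1), (- h); rewrite sqrrN expr1n mulrNN mul1r oppr_ge0.
have -> : `|h| = t.
  rewrite hE normrM (ger0_norm t0) (_ : `|b| = 1) ?mul1r//.
  by apply/eqP; rewrite -(@eqrXn2 _ 2)// -normrX b1 normr1 expr1n.
have h2 : h ^+ 2 = t ^+ 2 by rewrite hE exprMn b1 mul1r.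
have := taylor3_ub x b1 t0 up pq qL.
have := taylor3_ub x b1 t0 upN pqN qLN.
rewrite h2 hE ler_norml => h1' h2'; apply/andP; split; lra.
Qed.

End calculus.

(** * Smooth cutoffs obtained by averaging a ramp *)

Section cutoff.
Context {R : realType}.
Notation mu := (@lebesgue_measure R).

Lemma antiderivative (l : R -> R) : continuous l ->
  exists F : R -> R, forall x : R, is_derive x 1 F (l x).
Proof.
move=> cl.
pose J a x := (\int[mu]_(t in `[a, x]) l t)%R.
have il a b : mu.-integrable `[a, b] (EFin \o l).
  apply: continuous_compact_integrable; first exact: segment_compact.
  exact: continuous_subspaceT.
have Jind a a' x y : a <= x -> a' <= x -> x <= y ->
    J a y - J a x = J a' y - J a' x.
  move=> ax a'x xy.
  by rewrite /J !Rintegral_itvB//= ?bnd_simp.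
have Jind' a a' x y : a <= x -> a <= y -> a' <= x -> a' <= y ->
    J a y - J a x = J a' y - J a' x.
  move=> ax ay a'x a'y; have [xy|/ltW yx] := leP x y; first exact: Jind.
  by have := Jind a a' y x ay a'y yx; lra.
(* The base point moves with [x] so as to stay to the left of [x] and 0. Near a given [x] it can be
   frozen at [a], because moving it changes both integrals by the same amount. *)
pose F x := J (- (`|x| + 1)) x - J (- (`|x| + 1)) 0.
exists F => x.
pose a := - (`|x| + 2).
have ax : a < x.
  have : - `|x| <= x by have := lerNnormlW (lexx `|x|).
  rewrite /a; lra.
have x1 : x < x + 1 by rewrite ltrDl.
have [dJ J'] := continuous_FTC1_closed x1 (il a (x + 1)) ax (cl x).
have JE : is_derive x (1 : R) (J a) (l x).
  by apply: DeriveDef; [exact: dJ|rewrite -J' derive1E].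
have JE' : is_derive x (1 : R) (fun y => J a y - J a 0) (l x).
  by apply: is_derive_eq; rewrite subr0.
apply: near_eq_is_derive JE'.
near=> y.
have yx : `|x - y| < 1 by near: y; exact: nbhsx_ballx.
have := ler_norm x; have := ler_norm (- x); rewrite normrN => ? ?.
have := ler_norm y; have := ler_norm (- y); rewrite normrN => ? ?.
have := ler_norm (x - y); have := ler_norm (- (x - y)); rewrite normrN => ? ?.
have ny := normr_ge0 y; have nx := normr_ge0 x.
rewrite /F; apply: Jind'; rewrite ?/a; lra.
Unshelve. all: by end_near. Qed.

Definition clamp01 (t : R) : R := Num.max 0 (Num.min 1 t).

Lemma clamp01P (t : R) :
  [\/ t <= 0 /\ clamp01 t = 0, 0 <= t <= 1 /\ clamp01 t = t |
      1 <= t /\ clamp01 t = 1].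
Proof.
rewrite /clamp01; have [t1|t1] := leP 1 t.
  by apply: Or33; split=> //; apply/max_r/ler01.
have [t0|t0] := leP 0 t; last by apply: Or31; rewrite ltW.
by apply: Or32; split => //; rewrite ltW.
Qed.

Lemma clamp01_itv t : 0 <= clamp01 t <= 1.
Proof. by case: (clamp01P t) => -[? ->]//; rewrite ?lexx ?ler01. Qed.

Lemma clamp01_lip s t : `|clamp01 s - clamp01 t| <= `|s - t|.
Proof.
have := ler_norm (s - t); have := ler_norm (- (s - t)); rewrite normrN => ? ?.
case: (clamp01P s) => -[? ->]; case: (clamp01P t) => -[? ->];
  rewrite ler_norml; lra.
Qed.

(** A ramp in the distance [d] to [A], which is 1-Lipschitz: it descends from 1 to 0 as [d] goes
    from [c] to [c + r]. *)
Lemma lipschitz_cutoff (A : set R) (c r : R) : 0 <= c -> 0 < r ->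
  exists l : R -> R,
  [/\ forall x, 0 <= l x <= 1,
      forall x y, `|l x - l y| <= r^-1 * `|x - y|,
      forall x a, A a -> `|x - a| <= c -> l x = 1 &
      forall x, l x != 0 -> exists2 a, A a & `|x - a| < c + r].
Proof.
move=> c0 r0.
(* For empty [A] the infimum would default to 0 and put every point at distance 0. *)
have [->|/set0P A0] := eqVneq A set0.
  exists (fun=> 0); split => // [x|x y|x].
  - by rewrite lexx ler01.
  - rewrite subrr normr0; apply: mulr_ge0 => //.
    by rewrite invr_ge0 ltW.
  - by rewrite eqxx.
pose D x := [set `|x - a| | a in A].
pose d x := inf (D x).
have D0 x : D x !=set0 by case: A0 => a Aa; exists `|x - a|; exists a.
have Dlb x : has_lbound (D x) by exists 0 => _ [a _ <-].
have d_le x a : A a -> d x <= `|x - a|.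
  by move=> Aa; apply: ge_inf => //; exists a.
have d_lip x y : d x - `|x - y| <= d y.
  apply: lb_le_inf => // _ [a Aa <-].
  have := d_le x a Aa; have := ler_distD y x a; lra.
pose g x := (c + r - d x) / r.
have g_lip x y : `|g x - g y| <= r^-1 * `|x - y|.
  rewrite /g -mulrBl normrM mulrC (gtr0_norm (x := r^-1)) ?invr_gt0//.
  apply: ler_wpM2l; first by rewrite invr_ge0 ltW.
  have := d_lip x y; have := d_lip y x; rewrite (distrC y) ler_norml => ? ?.
  by apply/andP; split; lra.
exists (fun x => clamp01 (g x)); split.
- by move=> x; exact: clamp01_itv.
- by move=> x y; apply: le_trans (g_lip x y); exact: clamp01_lip.
- move=> x a Aa xa; have g1 : 1 <= g x.
    by rewrite /g ler_pdivlMr// mul1r; have := d_le x a Aa; lra.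
  by case: (clamp01P (g x)) => -[? ->] //; lra.
- move=> x gx0; have gx : 0 < g x.
    by move: gx0; case: (clamp01P (g x)) => -[? ->]; rewrite ?eqxx// => ?; lra.
  have dx : d x < c + r by move: gx; rewrite /g pmulr_lgt0 ?invr_gt0// subr_gt0.
  by have [_ [a Aa <-] xa] := inf_lt (D0 x) dx; exists a.
Qed.

(* The second difference of a second antiderivative of [l] is a weighted average of [l] on [[x - k, x + k]]. *)
Lemma second_difference_le (F f l : R -> R) (x k M : R) : 0 <= k ->
  (forall x : R, is_derive x 1 F (f x)) -> (forall x : R, is_derive x 1 f (l x)) ->
  (forall y, x - k <= y <= x + k -> l y <= M) ->
  F (x + k) - 2 * F x + F (x - k) <= M * k ^+ 2.
Proof.
move=> k0 dF df lM.
pose g s := F (x + 1 * s) - 2 * F x + F (x + - 1 * s) - M * s ^+ 2.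
have dg (s : R) : is_derive s 1 g (f (x + 1 * s) - f (x + - 1 * s) - 2 * M * s).
  have := is_derive_comp_affine x 1 dF s => ?.
  have := is_derive_comp_affine x (- 1) dF s => ?.
  by rewrite /g; apply: is_derive_eq; rewrite /GRing.scale /=; ring.
have cg : {within `[0, k], continuous g}.
  by apply: continuous_subspaceT; exact: is_derive_continuous dg.
have [c] := MVT_segment k0 (fun x _ => dg x) cg.
rewrite in_itv/= => /andP[c0 ck] gk.
have cf : {within `[x - c, x + c], continuous f}.
  by apply: continuous_subspaceT; exact: is_derive_continuous df.
have xc : x - c <= x + c by lra.
have [y] := MVT_segment xc (fun x _ => df x) cf.
rewrite in_itv/= => /andP[cy yc] fc.
have ly : l y <= M by apply: lM; apply/andP; split; lra.
have gkE : g k = F (x + k) - 2 * F x + F (x - k) - M * k ^+ 2.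
  by rewrite /g mul1r mulN1r.
have g0E : g 0 = 0 by rewrite /g !mulr0 !addr0; ring.
move: gk; rewrite gkE g0E mul1r mulN1r fc => gk.
have : (l y * (x + c - (x - c)) - 2 * M * c) * k <= 0.
  rewrite (_ : _ - _ = (l y - M) * (2 * c)); last ring.
  by rewrite -mulrA mulr_le0_ge0// ?subr_le0// mulr_ge0// mulr_ge0.
rewrite subr0 in gk; lra.
Qed.

(** With [k = e / 3], the ramp is 1 within [k] of [A] and 0 beyond [2 * k], so its average over
    windows of half-width [k] is still 1 on [A] and supported in the enlargement by [e]. That
    average is the normalized second difference [D] of a double antiderivative. Hence [q] is the
    second difference of the ramp itself, bounded by [2 / k ^+ 2 = 18 / e ^+ 2], with Lipschitz
    constant [4 / k ^+ 3 = 108 / e ^+ 3]. *)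
Lemma smooth_cutoff (A : set R) (e : R) : 0 < e ->
  exists u p q : R -> R,
  [/\ forall x : R, is_derive x 1 u (p x), forall x : R, is_derive x 1 p (q x),
      forall x y, `|q x - q y| <= 108 / e ^+ 3 * `|x - y|,
      forall x, 0 <= u x <= 1 /\ `|q x| <= 18 / e ^+ 2 &
      (forall x, A x -> u x = 1) /\
      (forall x, u x != 0 -> exists2 a, A a & `|x - a| < e)].
Proof.
move=> e0.
pose k := e / 3; have k0 : 0 < k by rewrite /k; lra.
have [l [l01 l_lip l1 l0]] := lipschitz_cutoff A (ltW k0) k0.
have cl : continuous l.
  move=> x; apply/cvgrPdist_le => d d0; near=> y.
  apply: le_trans (l_lip _ _) _.
  rewrite mulrC ler_pdivrMr//; near: y.
  by apply: cvgr_dist_le; [exact: cvg_id|exact: mulr_gt0].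
have [f df] := antiderivative cl.
have [F dF] := antiderivative (is_derive_continuous df).
have dfN (x : R) : is_derive x 1 (fun z => - f z) (- l x) by exact: is_deriveN.
have dFN (x : R) : is_derive x 1 (fun z => - F z) (- f x) by exact: is_deriveN.
pose D (h : R -> R) x := (h (x + k) - 2 * h x + h (x - k)) / k ^+ 2.
have dD (g dg : R -> R) : (forall x : R, is_derive x 1 g (dg x)) ->
    forall x : R, is_derive x 1 (D g) (D dg x).
  move=> gd x; rewrite /D.
  have d1 : is_derive x (1 : R) (fun y => g (y + k)) (dg (x + k)).
    have := is_derive_comp_affine k 1 gd x; rewrite mul1r.
    under eq_fun do rewrite mul1r addrC.
    by rewrite mul1r addrC.
  have d2 : is_derive x (1 : R) (fun y => g (y - k)) (dg (x - k)).
    have := is_derive_comp_affine (- k) 1 gd x; rewrite mul1r.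
    under eq_fun do rewrite mul1r addrC.
    by rewrite mul1r addrC.
  by apply: is_derive_eq; rewrite /GRing.scale /=; ring.
have k2 : 0 < k ^+ 2 by rewrite exprn_gt0.
exists (D F), (D f), (D l).
have ub x M : (forall y, x - k <= y <= x + k -> l y <= M) -> D F x <= M.
  move=> lM; rewrite /D ler_pdivrMr//.
  exact: second_difference_le (ltW k0) dF df lM.
have lb x M : (forall y, x - k <= y <= x + k -> M <= l y) -> M <= D F x.
  move=> lM; rewrite /D ler_pdivlMr//.
  have H y : x - k <= y <= x + k -> - l y <= - M by move=> /lM; rewrite lerN2.
  by have := second_difference_le (ltW k0) dFN dfN H; lra.
have ek : e = 3 * k by rewrite /k; field.
split.
- exact: dD.
- exact: dD.
- move=> x y; rewrite /D -mulrBl normrM (gtr0_norm (x := _^-1)) ?invr_gt0//.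
  rewrite ler_pdivrMr//.
  have := l_lip (x + k) (y + k); have := l_lip x y.
  have := l_lip (x - k) (y - k).
  rewrite !opprD !opprK !addrA.
  rewrite (_ : x - k - y + k = x - y); last ring.
  rewrite (_ : x + k - y - k = x - y); last ring.
  move=> H1 H2 H3.
  rewrite (_ : 108 / e ^+ 3 * `|x - y| * k ^+ 2 = 4 * (k^-1 * `|x - y|)); last first.
    by rewrite ek; field; rewrite gt_eqF.
  move: H1 H2 H3; rewrite !ler_norml => /andP[? ?] /andP[? ?] /andP[? ?].
  by apply/andP; split; lra.
- move=> x; split.
    by rewrite lb ?ub// => y _; case/andP: (l01 y).
  rewrite /D normrM (gtr0_norm (x := _^-1)) ?invr_gt0//.
  rewrite ler_pdivrMr// (_ : 18 / _ * _ = 2); last by rewrite ek; field; rewrite gt_eqF.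
  have := l01 (x + k); have := l01 x; have := l01 (x - k).
  move=> /andP[? ?] /andP[? ?] /andP[? ?].
  by rewrite ler_norml; apply/andP; split; lra.
- split.
    move=> x Ax; apply/eqP; rewrite eq_le ub ?lb//.
      move=> y ?; rewrite (l1 y x)// ler_norml; lra.
    by move=> y _; case/andP: (l01 y).
  move=> x; apply: contra_neqP => H.
  have ly y : x - k <= y <= x + k -> l y = 0.
    move=> /andP[y1 y2]; apply: contra_notP H => /eqP /l0[a Aa ya].
    exists a => //; have := ler_distD y x a.
    have : `|x - y| <= k by rewrite ler_norml; apply/andP; split; lra.
    lra.
  by apply/eqP; rewrite eq_le ub ?lb// => y /ly ->.
Unshelve. all: by end_near. Qed.
End cutoff.

(** * Gaussian averages *)

Section gaussian_average.
Context {R : realType}.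
Notation mu := (@lebesgue_measure R).
Implicit Types (f g phi : R -> R) (s x y : R).

(** A growth condition, not a tail condition: slower than every [expR (c * u ^+ 2)]. The class
    contains the polynomials, is closed under products, and is integrable against every Gaussian
    density. *)
Definition subgaussian f : Prop := forall c, 0 < c ->
  exists2 C, 0 <= C & forall u, `|f u| <= C * expR (c * u ^+ 2).

Lemma subgaussian_cst (a : R) : subgaussian (fun=> a).
Proof.
move=> c c0; exists `|a| => // u.
rewrite ler_peMr// -[leLHS]expR0 ler_expR; apply: mulr_ge0; [exact: ltW|exact: sqr_ge0].
Qed.

Lemma subgaussian_id : subgaussian id.
Proof.
move=> c c0; exists (1 + c^-1); first by rewrite addr_ge0 ?invr_ge0 ?ltW.
move=> u; apply: (@le_trans _ _ ((1 + c^-1) * (1 + c * u ^+ 2))).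
  have : 0 <= (`|u| - 1) ^+ 2 by rewrite sqr_ge0.
  rewrite (_ : _ ^+ 2 = `|u| ^+ 2 - 2 * `|u| + 1); last ring.
  rewrite real_normK ?num_real// => h.
  rewrite (_ : _ * _ = 1 + u ^+ 2 + c^-1 + c * u ^+ 2); last by field; rewrite gt_eqF.
  have : 0 <= c^-1 by rewrite invr_ge0 ltW.
  have : 0 <= c * u ^+ 2 by rewrite mulr_ge0 ?sqr_ge0 ?ltW.
  have := sqr_ge0 u; lra.
by rewrite ler_wpM2l ?expR_ge1Dx// addr_ge0 ?invr_ge0 ?ltW.
Qed.

Lemma subgaussianD f g : subgaussian f -> subgaussian g ->
  subgaussian (fun u => f u + g u).
Proof.
move=> hf hg c c0; have [C C0 fC] := hf c c0; have [D D0 gD] := hg c c0.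
exists (C + D); first exact: addr_ge0.
by move=> u; rewrite mulrDl (le_trans (ler_normD _ _))// lerD.
Qed.

Lemma subgaussianM f g : subgaussian f -> subgaussian g ->
  subgaussian (fun u => f u * g u).
Proof.
move=> hf hg c c0; have c2 : 0 < c / 2 by rewrite divr_gt0.
have [C C0 fC] := hf _ c2; have [D D0 gD] := hg _ c2.
exists (C * D); first exact: mulr_ge0.
move=> u; rewrite normrM.
rewrite (_ : c * u ^+ 2 = c / 2 * u ^+ 2 + c / 2 * u ^+ 2); last by field.
by rewrite expRD mulrACA ler_pM.
Qed.

Lemma subgaussianN f : subgaussian f -> subgaussian (fun u => - f u).
Proof.
move=> hf c /hf[C C0 fC]; exists C => // u; by rewrite normrN.
Qed.

Lemma subgaussianX f n : subgaussian f -> subgaussian (fun u => f u ^+ n).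
Proof.
move=> hf; elim: n => [|n IH]; first exact: subgaussian_cst.
by under eq_fun do rewrite exprS; exact: subgaussianM.
Qed.

(** Domination uniform for [x] within 1 of [a]. The growth of [f] costs a quarter of the Gaussian
    exponent; doubling the standard deviation absorbs this and the shift of the centre, since
    [(u + v) ^+ 2 <= 3 * u ^+ 2 + 3] when [|v| <= 1]. *)
Lemma normal_pdf_le s f (a : R) : 0 < s -> subgaussian f ->
  exists2 C, 0 <= C & forall x y, `|x - a| <= 1 ->
    `|f (y - x)| * normal_pdf x s y <= C * normal_pdf a (2 * s) y.
Proof.
move=> s0 hf.
have s20 : 0 < 2 * s by rewrite mulr_gt0.
pose c := (8 * s ^+ 2)^-1.
have c0 : 0 < c by rewrite invr_gt0 mulr_gt0// exprn_gt0.
have [C C0 fC] := hf c c0.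
have pk := normal_peak_gt0 (lt0r_neq0 s20).
exists (C * normal_peak s * expR (3 * c) / normal_peak (2 * s)).
  by rewrite !mulr_ge0// ?invr_ge0 ?expR_ge0 ?normal_peak_ge0.
move=> x y xa.
rewrite !normal_pdfE ?gt_eqF// /normal_fun.
rewrite [leRHS](_ : _ = C * normal_peak s *
    (expR (3 * c) * expR (- (y - a) ^+ 2 / ((2 * s) ^+ 2 *+ 2)))); last first.
  by field; rewrite gt_eqF.
rewrite -expRD.
apply: (@le_trans _ _ (C * expR (c * (y - x) ^+ 2) * (normal_peak s *
    expR (- (y - x) ^+ 2 / (s ^+ 2 *+ 2))))).
  by rewrite ler_wpM2r// mulr_ge0 ?expR_ge0 ?normal_peak_ge0.
rewrite mulrACA -expRD; apply: ler_wpM2l.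
  by rewrite mulr_ge0 ?normal_peak_ge0.
rewrite ler_expR.
have -> : c * (y - x) ^+ 2 + - (y - x) ^+ 2 / (s ^+ 2 *+ 2) = - (3 * c) * (y - x) ^+ 2.
  by rewrite /c; field; rewrite gt_eqF.
have -> : - (y - a) ^+ 2 / ((2 * s) ^+ 2 *+ 2) = - c * (y - a) ^+ 2.
  by rewrite /c; field; rewrite gt_eqF.
have : (x - a) ^+ 2 <= 1 by rewrite -(expr1n _ 2) -[leLHS]real_normK ?num_real// lerXn2r ?nnegrE.
have := sqr_ge0 (y - x - (x - a)).
rewrite (_ : y - a = (y - x) + (x - a)); last ring.
move: (y - x) (x - a) => u v h1 h2.
rewrite -subr_ge0 (_ : _ - _ = c * (3 + 3 * u ^+ 2 - (u + v) ^+ 2)); last ring.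
rewrite mulr_ge0 ?ltW//; nra.
Qed.

(** The mean of [phi (x + N) * f N] for N centred Gaussian of standard deviation [s]. In this form
    [x] enters only through [f] and the density, so smoothness in [x] does not come from [phi]. *)
Definition gauss_avg s phi f x := \int[mu]_y (phi y * f (y - x) * normal_pdf x s y).

Lemma measurable_gauss_avg s phi f x : measurable_fun setT phi ->
  measurable_fun setT f ->
  measurable_fun setT (fun y => phi y * f (y - x) * normal_pdf x s y).
Proof.
move=> mphi mf; apply: measurable_funM; last exact: measurable_normal_pdf.
apply: measurable_funM => //; apply: measurableT_comp => //.
exact: measurable_funB.
Qed.

Lemma integrable_gauss_avg s phi f x (M : R) : 0 < s ->
  measurable_fun setT phi -> (forall y, `|phi y| <= M) ->
  measurable_fun setT f -> subgaussian f ->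
  mu.-integrable setT (EFin \o (fun y => phi y * f (y - x) * normal_pdf x s y)).
Proof.
move=> s0 mphi phiM mf hf.
have [C C0 fC] := normal_pdf_le x s0 hf.
have i2 := integrable_normal_pdf x (2 * s).
have := integrableZl measurableT (M * C) i2.
apply: le_integrable => //.
  by apply/measurable_EFinP; exact: measurable_gauss_avg.
move=> y _ /=; rewrite lee_fin !normrM -mulrA.
have M0 : 0 <= M := le_trans (normr_ge0 _) (phiM 0).
rewrite (ger0_norm M0) (ger0_norm C0) -mulrA.
rewrite !(ger0_norm (normal_pdf_ge0 _ _ _)).
apply: ler_pM => //; first by rewrite mulr_ge0// normal_pdf_ge0.
by apply: fC; rewrite subrr normr0.
Qed.

Lemma is_derive_normal_pdf s x y : 0 < s ->
  is_derive x (1 : R) (fun z => normal_pdf z s y) ((y - x) / s ^+ 2 * normal_pdf x s y).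
Proof.
move=> s0.
under eq_fun do rewrite normal_pdfE ?gt_eqF//.
rewrite normal_pdfE ?gt_eqF// /normal_fun.
have h : is_derive x (1 : R) (fun z : R => - (y - z) ^+ 2 / (s ^+ 2 *+ 2)) ((y - x) / s ^+ 2).
  apply: is_derive_eq; rewrite /GRing.scale /=; field; by rewrite gt_eqF.
have := @is_derive1_comp _ (@expR R) (fun z : R => - (y - z) ^+ 2 / (s ^+ 2 *+ 2)) x _ _ (is_derive_expR _) h.
move=> h2; apply: is_derive_eq; rewrite /GRing.scale /=; ring.
Qed.

(** The adjoint of differentiation in the L^2 space of the centred Gaussian law of standard
    deviation [s]. *)
Definition gauss_dual s f (df : R -> R) u := u / s ^+ 2 * f u - df u.

(** Differentiation under the integral sign, with the dominating function of [normal_pdf_le] on the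
    interval of radius 1 around [x]. *)
Lemma is_derive_gauss_avg s phi f (df : R -> R) (M x : R) : 0 < s ->
  measurable_fun setT phi -> (forall y, `|phi y| <= M) ->
  (forall u : R, is_derive u 1 f (df u)) -> continuous df ->
  subgaussian f -> subgaussian df ->
  is_derive x 1 (gauss_avg s phi f) (gauss_avg s phi (gauss_dual s f df) x).
Proof.
move=> s0 mphi phiM fd cdf hf hdf.
have mf : measurable_fun setT f.
  by apply: continuous_measurable_fun; exact: is_derive_continuous fd.
have mdf : measurable_fun setT df by exact: continuous_measurable_fun.
pose k x y := phi y * f (y - x) * normal_pdf x s y.
have dk (z y : R) : is_derive z 1 (k ^~ y)
    (phi y * gauss_dual s f df (y - z) * normal_pdf z s y).
  have := is_derive_normal_pdf z y s0 => ?.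
  have := is_derive_comp_affine y (- 1) fd z.
  under eq_fun do rewrite mulN1r.
  rewrite !mulN1r => ?.
  rewrite /k; apply: is_derive_eq; rewrite /GRing.scale /= /gauss_dual; ring.
have hg : subgaussian (gauss_dual s f df).
  apply: subgaussianD; last exact: subgaussianN.
  apply: subgaussianM => //; apply: subgaussianM; first exact: subgaussian_id.
  exact: subgaussian_cst.
have [C C0 gC] := normal_pdf_le x s0 hg.
have M0 : 0 <= M := le_trans (normr_ge0 _) (phiM 0).
pose B y := M * C * normal_pdf x (2 * s) y.
have B0 y : 0 <= B y by rewrite !mulr_ge0// normal_pdf_ge0.
have iB : mu.-integrable setT (EFin \o B).
  exact: (integrableZl measurableT (M * C) (integrable_normal_pdf x (2 * s))).
have xI : x \in `](x - 1), (x + 1)[ by rewrite in_itv/=; apply/andP; split; lra.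
have ik z : `](x - 1), (x + 1)[%classic z -> mu.-integrable setT (EFin \o k z).
  by move=> _; exact: integrable_gauss_avg phiM _ hf.
have dk' z y : `](x - 1), (x + 1)[%classic z -> setT y -> derivable (k ^~ y) z 1.
  by move=> _ _; have [] := dk z y.
have pE z y : partial1of2 k z y =
    phi y * gauss_dual s f df (y - z) * normal_pdf z s y.
  by rewrite partial1of2E; exact: derive_val.
have ub z y : `](x - 1), (x + 1)[%classic z -> setT y ->
    `|partial1of2 k z y| <= B y.
  rewrite /= in_itv/= => /andP[z1 z2] _; rewrite pE !normrM -mulrA /B -mulrA.
  rewrite (ger0_norm (normal_pdf_ge0 _ _ _)).
  apply: ler_pM => //; first by rewrite mulr_ge0// normal_pdf_ge0.
  by apply: gC; rewrite ler_norml; apply/andP; split; lra.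
have -> : gauss_avg s phi (gauss_dual s f df) x =
    \int[mu]_y (partial1of2 k ^~ y) x.
  by apply: eq_Rintegral => y _; rewrite pE.
apply: DeriveDef.
  exact: (derivable_under_integral measurableT xI ik dk' B0 iB ub).
rewrite -(differentiation_under_integral measurableT xI ik dk' B0 iB ub).
by rewrite derive1E.
Qed.
End gaussian_average.

(** * Hermite weights, Gaussian moments and derivatives of Gaussian averages *)

Section gaussian_smoothing.
Context {R : realType}.
Notation mu := (@lebesgue_measure R).
Implicit Types (f g phi : R -> R) (s x y : R).

Definition tame f := measurable_fun setT f /\ subgaussian f.

Lemma tame_cst (a : R) : tame (fun=> a).
Proof. by split => //; exact: subgaussian_cst. Qed.

Lemma tame_id : tame id.
Proof. by split => //; exact: subgaussian_id. Qed.

Lemma tameD f g : tame f -> tame g -> tame (fun u => f u + g u).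
Proof. by move=> [? ?] [? ?]; split; [exact: measurable_funD|exact: subgaussianD]. Qed.

Lemma tameM f g : tame f -> tame g -> tame (fun u => f u * g u).
Proof. by move=> [? ?] [? ?]; split; [exact: measurable_funM|exact: subgaussianM]. Qed.

Lemma tameX f n : tame f -> tame (fun u => f u ^+ n).
Proof. by move=> [? ?]; split; [exact: measurable_funX|exact: subgaussianX]. Qed.

(** For [e = s^-2] this is [s^-n * He_n (u / s)], with [He_n] the monic Hermite polynomials of the
    standard normal law. *)
Fixpoint hermite (e : R) (n : nat) (u : R) : R :=
  match n with
  | 0 => 1
  | m.+1 => match m with
            | 0 => e * u
            | k.+1 => e * (u * hermite e m u - m%:R * hermite e k u)
            end
  end.

Lemma hermiteS e n u :
  hermite e n.+1 u = e * (u * hermite e n u - n%:R * hermite e n.-1 u).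
Proof. by case: n => [|n] //=; rewrite mul0r subr0 mulr1. Qed.

Lemma tame_hermite e n : tame (hermite e n).
Proof.
suff : tame (hermite e n) /\ tame (hermite e n.+1) by case.
elim: n => [|n [IH1 IH2]].
  split; first exact: tame_cst.
  by apply: tameM; [exact: tame_cst|exact: tame_id].
split=> //.
apply: (tameM (f := fun=> e)); first exact: tame_cst.
apply: (tameD (g := fun u => - (n.+1%:R * hermite e n u))).
  by apply: (tameM (f := id)) => //; exact: tame_id.
under eq_fun do rewrite -mulNr.
by apply: tameM => //; exact: tame_cst.
Qed.

Lemma is_derive_hermite e n (u : R) :
  is_derive u 1 (hermite e n) (n%:R * e * hermite e n.-1 u).
Proof.
suff : is_derive u 1 (hermite e n) (n%:R * e * hermite e n.-1 u) /\
  is_derive u 1 (hermite e n.+1) (n.+1%:R * e * hermite e n u) by case.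
elim: n => [|n [IH1 IH2]].
  split; first by rewrite !mul0r; exact: is_derive_cst.
  by rewrite /=; apply: is_derive_eq; rewrite /GRing.scale /=; ring.
split => //.
have -> : hermite e n.+2 =
  (fun u => e * (u * hermite e n.+1 u - n.+1%:R * hermite e n u)) by [].
apply: is_derive_eq.
have E := hermiteS e n u; rewrite /GRing.scale /=; rewrite /= in E.
rewrite E -(natr1 n.+1) -!natr1; ring.
Qed.

Lemma continuous_hermite e n : continuous (hermite e n).
Proof. exact: is_derive_continuous (is_derive_hermite e n). Qed.

(** The three-term recursion says that the adjoint of differentiation raises the degree by one. The
    k-th derivative of a Gaussian average is thus the average with Hermite weight of degree k. *)
Lemma gauss_dual_hermite s n :
  gauss_dual s (hermite (s ^+ 2)^-1 n)
     (fun u => n%:R * (s ^+ 2)^-1 * hermite (s ^+ 2)^-1 n.-1 u) =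
  hermite (s ^+ 2)^-1 n.+1.
Proof. by apply/funext => u; rewrite hermiteS /gauss_dual; ring. Qed.

Lemma is_derive_gauss_hermite s phi (M x : R) n : 0 < s ->
  measurable_fun setT phi -> (forall y, `|phi y| <= M) ->
  is_derive x 1 (gauss_avg s phi (hermite (s ^+ 2)^-1 n))
    (gauss_avg s phi (hermite (s ^+ 2)^-1 n.+1) x).
Proof.
move=> s0 mphi phiM; rewrite -gauss_dual_hermite.
apply: (is_derive_gauss_avg _ s0 mphi phiM).
- exact: is_derive_hermite.
- move=> u; apply: cvgM; [exact: cvg_cst|exact: continuous_hermite].
- by have [] := tame_hermite (s ^+ 2)^-1 n.
- apply: subgaussianM; first exact: subgaussian_cst.
  by have [] := tame_hermite (s ^+ 2)^-1 n.-1.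
Qed.

Lemma gauss_avg_lin s phi f g (a b M x : R) : 0 < s ->
  measurable_fun setT phi -> (forall y, `|phi y| <= M) -> tame f -> tame g ->
  gauss_avg s phi (fun u => a * f u + b * g u) x =
  a * gauss_avg s phi f x + b * gauss_avg s phi g x.
Proof.
move=> s0 mphi phiM [mf hf] [mg hg].
have If := integrable_gauss_avg x s0 mphi phiM mf hf.
have Ig := integrable_gauss_avg x s0 mphi phiM mg hg.
rewrite /gauss_avg -RintegralZl// -RintegralZl// -RintegralD//.
- by apply: eq_Rintegral => y _; ring.
- by have := integrableZl measurableT a If; apply: eq_integrable => //.
- by have := integrableZl measurableT b Ig; apply: eq_integrable => //.
Qed.

Definition gauss_mean s f x := gauss_avg s (fun=> 1) f x.

Lemma gauss_mean_lin s f g (a b x : R) : 0 < s -> tame f -> tame g ->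
  gauss_mean s (fun u => a * f u + b * g u) x =
  a * gauss_mean s f x + b * gauss_mean s g x.
Proof.
by move=> s0; apply: (@gauss_avg_lin _ _ _ _ _ _ 1) => // y; rewrite normr1.
Qed.

Lemma gauss_mean1 s x : gauss_mean s (fun=> 1) x = 1.
Proof.
rewrite /gauss_mean /gauss_avg; under eq_Rintegral do rewrite !mul1r.
by rewrite /Rintegral integral_normal_pdf.
Qed.

(** The mean of the Hermite polynomial of degree [n] is constant in the centre [x], and the mean in
    degree [n.+1] is its derivative. *)
Lemma gauss_mean_hermite s n x : 0 < s ->
  gauss_mean s (hermite (s ^+ 2)^-1 n.+1) x = 0.
Proof.
move=> s0.
have b1 (y : R) : `|1 : R| <= 1 by rewrite normr1.
have d k (y : R) : is_derive y 1 (gauss_mean s (hermite (s ^+ 2)^-1 k))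
    (gauss_mean s (hermite (s ^+ 2)^-1 k.+1) y).
  exact: (is_derive_gauss_hermite _ _ s0 (measurable_cst _) b1).
have [c cE] : exists c : R, gauss_mean s (hermite (s ^+ 2)^-1 n) = cst c.
  elim: n => [|n [c cE]]; first by exists 1; apply/funext => y; exact: gauss_mean1.
  exists 0; apply/funext => y.
  by have := d n y; rewrite cE => dy; rewrite -(@derive_val _ _ _ _ _ _ _ dy) derive_cst.
by have := d n x; rewrite cE => dy; rewrite -(@derive_val _ _ _ _ _ _ _ dy) derive_cst.
Qed.

(** The shape of a Hermite expansion with up to three nonconstant terms: a Gaussian moment is then
    read off as the constant [k]. Shorter expansions are padded with zero terms. *)
Lemma gauss_mean_sum3 s f g h (a b c k x : R) : 0 < s -> tame f -> tame g -> tame h ->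
  gauss_mean s (fun u => a * f u + b * g u + c * h u + k) x =
  a * gauss_mean s f x + b * gauss_mean s g x + c * gauss_mean s h x + k.
Proof.
move=> s0 tf tg th.
have ts (r : R) w : tame w -> tame (fun u => r * w u).
  by move=> ?; apply: tameM => //; exact: tame_cst.
have -> : (fun u => a * f u + b * g u + c * h u + k) =
    (fun u => 1 * (1 * (a * f u + b * g u) + c * h u) + k * (fun=> 1) u).
  by apply/funext => u /=; ring.
have tab : tame (fun u => a * f u + b * g u) by apply: tameD; exact: ts.
have tabc : tame (fun u => 1 * (a * f u + b * g u) + c * h u).
  by apply: tameD; exact: ts.
rewrite (gauss_mean_lin _ _ _ s0 tabc (tame_cst 1)).
rewrite (gauss_mean_lin _ _ _ s0 tab th) (gauss_mean_lin _ _ _ s0 tf tg).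
by rewrite gauss_mean1 !mul1r mulr1.
Qed.

Lemma gauss_mean_id s x : 0 < s -> gauss_mean s id x = 0.
Proof.
move=> s0.
have e0 : (s ^+ 2)^-1 != 0 by rewrite invr_eq0 gt_eqF// exprn_gt0.
have := gauss_mean_hermite 0 x s0; set e := (s ^+ 2)^-1.
have -> : hermite e 1 = (fun u => e * id u + 0 * id u + 0 * id u + 0).
  by apply/funext => u /=; ring.
rewrite gauss_mean_sum3//; try exact: tame_id.
by rewrite !mul0r !addr0 => /eqP; rewrite mulf_eq0 (negbTE e0) => /eqP.
Qed.

Lemma gauss_mean2 s x : 0 < s -> gauss_mean s (fun u => u ^+ 2) x = s ^+ 2.
Proof.
move=> s0.
have -> : (fun u => u ^+ 2) = (fun u => s ^+ 4 * hermite (s ^+ 2)^-1 2 u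
    + 0 * id u + 0 * id u + s ^+ 2).
  by apply/funext => u /=; field; rewrite gt_eqF.
rewrite gauss_mean_sum3//; try exact: tame_id; last exact: tame_hermite.
by rewrite gauss_mean_hermite// mulr0 !mul0r !add0r.
Qed.

Lemma gauss_mean4 s x : 0 < s -> gauss_mean s (fun u => u ^+ 4) x = 3 * s ^+ 4.
Proof.
move=> s0.
have -> : (fun u => u ^+ 4) = (fun u => s ^+ 8 * hermite (s ^+ 2)^-1 4 u
    + 6 * s ^+ 6 * hermite (s ^+ 2)^-1 2 u + 0 * id u + 3 * s ^+ 4).
  by apply/funext => u /=; field; rewrite gt_eqF.
rewrite gauss_mean_sum3//; try exact: tame_id; try exact: tame_hermite.
by rewrite !gauss_mean_hermite// !mulr0 !mul0r !add0r.
Qed.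

Lemma gauss_mean_hermite3_sqr s x : 0 < s ->
  gauss_mean s (fun u => hermite (s ^+ 2)^-1 3 u ^+ 2) x = 6 / s ^+ 6.
Proof.
move=> s0; set e := (s ^+ 2)^-1.
have -> : (fun u => hermite e 3 u ^+ 2) = (fun u => 1 * hermite e 6 u
    + 9 * e * hermite e 4 u + 18 * e ^+ 2 * hermite e 2 u + 6 * e ^+ 3).
  by apply/funext => u /=; ring.
rewrite gauss_mean_sum3//; try exact: tame_hermite.
rewrite !gauss_mean_hermite// !mulr0 !add0r /e; by field; rewrite gt_eqF.
Qed.

(** The weight has mean 0, so [phi] may be replaced by [phi - 1/2], of absolute value at most 1/2.
    What remains is half the L^1 norm of the weight, at most half its L^2 norm [sqrt 6 / s ^+ 3];
    49/40 is just above [sqrt 6 / 2]. *)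
Lemma gauss_avg_hermite3_le s phi x : 0 < s -> measurable_fun setT phi ->
  (forall y, 0 <= phi y <= 1) ->
  `|gauss_avg s phi (hermite (s ^+ 2)^-1 3) x| <= 49 / 40 / s ^+ 3.
Proof.
move=> s0 mphi phi01; set e := (s ^+ 2)^-1.
have [mH hH] := tame_hermite e 3.
have phi1 y : `|phi y| <= 1 by rewrite ler_norml; have := phi01 y; lra.
have mphi' : measurable_fun setT (fun y => phi y - 2^-1) by exact: measurable_funB.
have phi2 y : `|phi y - 2^-1| <= 2^-1.
  by rewrite ler_norml; have := phi01 y => /andP[? ?]; apply/andP; split; lra.
have I1 := integrable_gauss_avg x s0 mphi' phi2 mH hH.
have b1 (y : R) : `|1 : R| <= 1 by rewrite normr1.
have I2 := integrable_gauss_avg x s0 (measurable_cst _) b1 mH hH.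
have -> : gauss_avg s phi (hermite e 3) x =
    gauss_avg s (fun y => phi y - 2^-1) (hermite e 3) x.
  apply/eqP; rewrite -subr_eq0; apply/eqP.
  transitivity (2^-1 * gauss_mean s (hermite e 3) x); last first.
    by rewrite gauss_mean_hermite// mulr0.
  have I3 := integrable_gauss_avg x s0 mphi phi1 mH hH.
  rewrite /gauss_mean /gauss_avg -RintegralB// -RintegralZl//.
  by apply: eq_Rintegral => y _; ring.
apply: le_trans (le_normr_Rintegral _ I1) _ => //.
(* [|H| <= (b + H ^+ 2 / b) / 2], and [b] close to the L^2 norm [sqrt 6 / s ^+ 3] of [H] *)
pose b := 5 / 2 / s ^+ 3.
have b0 : 0 < b by rewrite /b !divr_gt0// exprn_gt0.
have tH : tame (fun u => hermite e 3 u ^+ 2) by apply: tameX; exact: tame_hermite.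
pose g u := (4 * b)^-1 * hermite e 3 u ^+ 2 + 0 * id u + 0 * id u + b / 4.
have tg : tame g.
  apply: tameD; last exact: tame_cst.
  by do 2 (apply: tameD; last by apply: tameM; [exact: tame_cst|exact: tame_id]);
    apply: tameM => //; exact: tame_cst.
have I4 := integrable_gauss_avg x s0 (measurable_cst _) b1 tg.1 tg.2.
apply: (@le_trans _ _ (gauss_mean s g x)); last first.
  rewrite gauss_mean_sum3//; try exact: tame_id.
  rewrite gauss_mean_hermite3_sqr// !mul0r !addr0 /b.
  rewrite le_eqVlt; apply/orP; left; apply/eqP; field.
  by rewrite gt_eqF.
apply: le_Rintegral => //.
  exact: (integrable_norm I1).
move=> y _; rewrite normrM mul1r (ger0_norm (normal_pdf_ge0 _ _ _)).
rewrite ler_wpM2r ?normal_pdf_ge0// normrM.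
set H := hermite _ _ _.
apply: (@le_trans _ _ (2^-1 * `|H|)); first by rewrite ler_wpM2r.
have : 0 <= (`|H| - b) ^+ 2 by rewrite sqr_ge0.
rewrite (_ : (_ - _) ^+ 2 = `|H| ^+ 2 - 2 * `|H| * b + b ^+ 2); last ring.
rewrite real_normK ?num_real// => h.
rewrite /g !mul0r !addr0 -/H -subr_ge0.
rewrite (_ : _ - _ = (4 * b)^-1 * (H ^+ 2 - 2 * `|H| * b + b ^+ 2)); last first.
  by field; rewrite gt_eqF.
by rewrite mulr_ge0// invr_ge0 mulr_ge0// ltW.
Qed.

Lemma taylor3_gauss_avg s phi : 0 < s -> measurable_fun setT phi ->
  (forall y, 0 <= phi y <= 1) ->
  taylor3 (49 / 40 / s ^+ 3) (gauss_avg s phi (hermite (s ^+ 2)^-1 0))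
    (gauss_avg s phi (hermite (s ^+ 2)^-1 1))
    (gauss_avg s phi (hermite (s ^+ 2)^-1 2)).
Proof.
move=> s0 mphi phi01.
have phi1 y : `|phi y| <= 1 by rewrite ler_norml; have := phi01 y; lra.
have d n x := is_derive_gauss_hermite x n s0 mphi phi1.
apply: taylor3_of_derive => //.
by apply: lipschitz_of_derive (d 2%N) _ => x; exact: gauss_avg_hermite3_le.
Qed.

End gaussian_smoothing.

(** * The heat semigroup *)

Section heat.
Context {R : realType}.
Notation mu := (@lebesgue_measure R).
Implicit Types (f g phi u p q : R -> R) (s t x y : R).

(** Parametrized by the standard deviation [s], so the time is [s ^+ 2]. The weight 1 is the Hermite
    polynomial of degree 0, which makes the Hermite lemmas applicable by conversion. *)
Definition heat s u x := gauss_avg s u (fun=> 1) x.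

Lemma integrable_heat s u (M x : R) : 0 < s -> measurable_fun setT u ->
  (forall y, `|u y| <= M) ->
  mu.-integrable setT (EFin \o (fun y => u y * 1 * normal_pdf x s y)).
Proof.
move=> s0 mu0 uM; have [? ?] := @tame_cst R 1.
exact: (@integrable_gauss_avg _ s u (fun=> 1) x M).
Qed.

Lemma continuous_heat s u (M : R) : 0 < s -> measurable_fun setT u ->
  (forall y, `|u y| <= M) -> continuous (heat s u).
Proof.
move=> s0 mu0 uM.
apply: is_derive_continuous => x.
exact: (@is_derive_gauss_hermite _ s u M x 0).
Qed.

Lemma heat_le s u g (M N x : R) : 0 < s -> measurable_fun setT u ->
  measurable_fun setT g -> (forall y, `|u y| <= M) -> (forall y, `|g y| <= N) ->
  (forall y, u y <= g y) -> heat s u x <= heat s g x.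
Proof.
move=> s0 mu0 mg uM gN ug; apply: le_Rintegral => //.
- exact: (integrable_heat x s0 mu0 uM).
- exact: (integrable_heat x s0 mg gN).
- by move=> y _; rewrite !mulr1 ler_wpM2r ?normal_pdf_ge0.
Qed.

Lemma heat_cst s (c x : R) : 0 < s -> heat s (fun=> c) x = c.
Proof.
move=> s0; rewrite -[RHS]mulr1 -(gauss_mean1 s x) /gauss_mean /gauss_avg -RintegralZl//.
  by apply: eq_Rintegral => y _; ring.
apply: (@integrable_heat s (fun=> 1) 1 x s0) => // y; by rewrite normr1.
Qed.

Lemma heat_itv s u x : 0 < s -> measurable_fun setT u ->
  (forall y, 0 <= u y <= 1) -> 0 <= heat s u x <= 1.
Proof.
move=> s0 mu0 u01.
have uM y : `|u y| <= 1 by rewrite ler_norml; have := u01 y; lra.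
have cM (c : R) (y : R) : `|c| <= `|c| by [].
apply/andP; split.
  rewrite -[leLHS](heat_cst 0 x s0).
  apply: (heat_le x s0 (measurable_cst _) mu0 (cM 0) uM) => y.
  by have /andP[] := u01 y.
rewrite -[leRHS](heat_cst 1 x s0).
apply: (heat_le x s0 mu0 (measurable_cst _) uM (cM 1)) => y.
by have /andP[] := u01 y.
Qed.

(** Moves a translation from the centre of the kernel to the function, so that a pointwise
    inequality on [u] can be averaged. *)
Lemma heat_shift s u (h x : R) : 0 < s -> continuous u -> (forall y, 0 <= u y) ->
  heat s u (x + h) = heat s (fun y => u (y + h)) x.
Proof.
move=> s0 cu u0; rewrite /heat /gauss_avg /Rintegral; congr fine.
have dF (y : R) : is_derive y 1 (fun z => z + h) 1.
  by apply: is_derive_eq; rewrite addr0.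
have F'E : (fun z => z + h)^`()%classic = cst (1 : R).
  by apply/funext => y; rewrite derive1E; exact: derive_val.
rewrite (@increasing_ge0_integration_by_substitutionT _ (fun z => z + h)
   (fun y => u y * 1 * normal_pdf (x + h) s y)).
- apply: eq_integral => y _; congr EFin.
  rewrite F'E /=  /GRing.mul /= -/(GRing.mul _ _).
  rewrite [RHS](_ : _ = u (y + h) * 1 * normal_pdf (x + h) s (y + h) * 1)//.
  rewrite mulr1 !normal_pdfE ?gt_eqF// /normal_fun.
  by rewrite (_ : y + h - (x + h) = y - x)//; ring.
- by move=> y z yz; rewrite ltrD2r.
- by rewrite F'E => y; exact: cvg_cst.
- by rewrite F'E; exact: is_cvg_cst.
- by rewrite F'E; exact: is_cvg_cst.
- by move=> y; have [] := dF y.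
- exact: cvg_addrr_Ny.
- exact: cvg_addrr.
- move=> y; apply: cvgM; last exact: continuous_normal_pdf (lt0r_neq0 s0) y.
  by apply: cvgM; [exact: cu|exact: cvg_cst].
- by move=> y; rewrite mulr1 mulr_ge0// normal_pdf_ge0.
Qed.

Lemma heat_lin s f g (M N a b x : R) : 0 < s -> measurable_fun setT f ->
  measurable_fun setT g -> (forall y, `|f y| <= M) -> (forall y, `|g y| <= N) ->
  heat s (fun y => a * f y + b * g y) x = a * heat s f x + b * heat s g x.
Proof.
move=> s0 mf mg fM gN.
have If := integrable_heat x s0 mf fM; have Ig := integrable_heat x s0 mg gN.
rewrite /heat /gauss_avg -RintegralZl// -RintegralZl// -RintegralD//.
- by apply: eq_Rintegral => y _; ring.
- by have := integrableZl measurableT a If; apply: eq_integrable => //.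
- by have := integrableZl measurableT b Ig; apply: eq_integrable => //.
Qed.

(** The remainder of the averaged triple is the average of the remainder [g], and [heat] preserves
    constant bounds. *)
Lemma taylor3_heat (L M s : R) u p q : 0 < s -> 0 <= L -> continuous u -> continuous p ->
  continuous q -> (forall y, 0 <= u y <= 1) -> (forall y, `|p y| <= M) ->
  (forall y, `|q y| <= M) ->
  taylor3 L u p q -> taylor3 L (heat s u) (heat s p) (heat s q).
Proof.
move=> s0 L0 cu cp cq u01 pM qM T x h.
have m_ f : continuous f -> measurable_fun setT f := @continuous_measurable_fun _ f.
have uM y : `|u y| <= 1 by rewrite ler_norml; have := u01 y; lra.
have cuh : continuous (fun y => u (y + h)).
  move=> y; apply: (@cvg_comp _ _ _ (fun y => y + h) u); last exact: cu.
  by apply: cvgD; [exact: cvg_id|exact: cvg_cst].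
have uhM y : `|u (y + h)| <= 1 by exact: uM.
rewrite heat_shift//; last by move=> y; have /andP[] := u01 y.
pose g y := u (y + h) - u y - p y * h - q y * h ^+ 2 / 2.
have M0 : 0 <= M := le_trans (normr_ge0 _) (pM 0).
have mg : measurable_fun setT g.
  apply: measurable_funB; last first.
    by apply: measurable_funM => //; apply: measurable_funM => //; exact: m_.
  apply: measurable_funB; last by apply: measurable_funM => //; exact: m_.
  by apply: measurable_funB; exact: m_.
have gM y : `|g y| <= L / 6 * `|h| ^+ 3 by exact: T.
pose f1 y := 1 * u (y + h) + (-1) * u y.
pose f2 y := (- h) * p y + (- (h ^+ 2 / 2)) * q y.
have f1M y : `|f1 y| <= 2.
  have := uhM y; have := uM y; rewrite !ler_norml /f1 => /andP[? ?] /andP[? ?].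
  by apply/andP; split; lra.
have f2M y : `|f2 y| <= `|h| * M + `|h ^+ 2 / 2| * M.
  rewrite /f2 (le_trans (ler_normD _ _))// lerD// normrM normrN ler_wpM2l//.
have mf1 : measurable_fun setT f1.
  by apply: measurable_funD; apply: measurable_funM => //; exact: m_.
have mf2 : measurable_fun setT f2.
  by apply: measurable_funD; apply: measurable_funM => //; exact: m_.
have gE : g = (fun y => 1 * f1 y + 1 * f2 y).
  by apply/funext => y; rewrite /g /f1 /f2; ring.
have -> : heat s (fun y => u (y + h)) x - heat s u x - heat s p x * h -
    heat s q x * h ^+ 2 / 2 = heat s g x.
  rewrite gE (heat_lin 1 1 x s0 mf1 mf2 f1M f2M).
  rewrite (heat_lin 1 (-1) x s0 (m_ _ cuh) (m_ _ cu) uhM uM).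
  by rewrite (heat_lin _ _ x s0 (m_ _ cp) (m_ _ cq) pM qM); ring.
set B := L / 6 * `|h| ^+ 3.
have B0 : 0 <= B by rewrite mulr_ge0// ?exprn_ge0// divr_ge0.
have cM (c : R) (y : R) : `|c| <= `|c| by [].
rewrite ler_norml; apply/andP; split.
  rewrite -[leLHS](heat_cst (- B) x s0).
  apply: (heat_le x s0 (measurable_cst _) mg (cM (- B)) gM) => y.
  by have := gM y; rewrite ler_norml => /andP[].
rewrite -[leRHS](heat_cst B x s0).
apply: (heat_le x s0 mg (measurable_cst _) gM (cM B)) => y.
by have := gM y; rewrite ler_norml => /andP[].
Qed.

(* The cubic remainder is integrated through [|v|^3 <= s v^2 + v^4 / (4 s)], whence the factor [7 / 4 = 1 + 3 / 4]. *)
Lemma heat_ge_taylor3 (L M s x : R) u p q : 0 < s -> 0 <= L -> measurable_fun setT u ->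
  (forall y, `|u y| <= M) -> taylor3 L u p q ->
  u x + q x * s ^+ 2 / 2 - L / 6 * (7 / 4 * s ^+ 3) <= heat s u x.
Proof.
move=> s0 L0 mu0 uM T.
(* A quartic minorant of [v |-> u (x + v)], whose Gaussian mean is known exactly. *)
pose h (v : R) := p x * id v + (q x / 2 - L / 6 * s) * v ^+ 2 +
  (- (L / 6 / (4 * s))) * v ^+ 4 + u x.
have t2 : tame (fun v : R => v ^+ 2) by apply: tameX; exact: tame_id.
have t4 : tame (fun v : R => v ^+ 4) by apply: tameX; exact: tame_id.
have th : tame h.
  apply: tameD; last exact: tame_cst.
  by do ![apply: tameD | apply: tameM]; try exact: tame_cst; try exact: tame_id.
have b1 (y : R) : `|1 : R| <= 1 by rewrite normr1.
have Ih := integrable_gauss_avg x s0 (measurable_cst _) b1 th.1 th.2.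
apply: (@le_trans _ _ (gauss_mean s h x)).
  rewrite gauss_mean_sum3//; last exact: tame_id.
  rewrite gauss_mean_id// gauss_mean2// gauss_mean4//.
  by rewrite le_eqVlt; apply/orP; left; apply/eqP; field; rewrite gt_eqF.
apply: le_Rintegral => //.
  exact: (integrable_heat x s0 mu0 uM).
move=> y _; rewrite mul1r mulr1 ler_wpM2r ?normal_pdf_ge0//.
have := T x (y - x); rewrite (_ : x + (y - x) = y); last ring.
set v := y - x; rewrite ler_norml => /andP[H _].
have nv : `|v| ^+ 3 <= s * v ^+ 2 + v ^+ 4 / (4 * s).
  have v2 : `|v| ^+ 2 = v ^+ 2 by rewrite real_normK ?num_real.
  have v4 : `|v| ^+ 4 = v ^+ 4 by rewrite (exprM _ 2 2) v2 -exprM.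
  rewrite -v4 -v2 -subr_ge0.
  rewrite (_ : _ - _ = `|v| ^+ 2 * (2 * s - `|v|) ^+ 2 / (4 * s)); last first.
    by field; rewrite gt_eqF.
  by apply: divr_ge0; [rewrite mulr_ge0 ?sqr_ge0|rewrite mulr_ge0 ?(ltW s0)].
have LB : L / 6 * `|v| ^+ 3 <= L / 6 * (s * v ^+ 2 + v ^+ 4 / (4 * s)).
  by rewrite ler_wpM2l// divr_ge0.
have e4 : L / 6 * (s * v ^+ 2 + v ^+ 4 / (4 * s)) = L / 6 * s * v ^+ 2 + L / 6 / (4 * s) * v ^+ 4.
  by field; rewrite gt_eqF.
by move: H LB; rewrite e4 /h /=; clear; move=> H LB; lra.
Qed.

(** Completing the square: the joint density of an intermediate point [w] and an end point [y] is
    the density of [y] times the conditional density of [w] given [y]. *)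
Lemma normal_pdf_mul s t x y w : 0 < s -> 0 < t ->
  let r := Num.sqrt (s ^+ 2 + t ^+ 2) in
  normal_pdf w t y * normal_pdf x s w =
  normal_pdf x r y *
    normal_pdf ((t ^+ 2 * x + s ^+ 2 * y) / r ^+ 2) (s * t / r) w.
Proof.
move=> s0 t0 r.
have st0 : 0 < s ^+ 2 + t ^+ 2 by rewrite addr_gt0// exprn_gt0.
have r0 : 0 < r by rewrite sqrtr_gt0.
have r2 : r ^+ 2 = s ^+ 2 + t ^+ 2 by rewrite sqr_sqrtr// ltW.
have q0 : 0 < s * t / r by rewrite divr_gt0 ?mulr_gt0.
have pkE (a : R) : 0 < a -> normal_peak a = (a * Num.sqrt (pi *+ 2))^-1.
  move=> a0; rewrite /normal_peak -mulrnAr sqrtrM ?sqr_ge0//.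
  by rewrite sqrtr_sqr gtr0_norm.
have p0 : Num.sqrt (pi *+ 2) != 0 :> R.
  by rewrite gt_eqF// sqrtr_gt0 mulrn_wgt0// pi_gt0.
rewrite !normal_pdfE ?gt_eqF// /normal_fun !pkE//.
rewrite mulrACA [RHS]mulrACA -!expRD; congr (_ * expR _).
  by field; rewrite p0 !gt_eqF.
have -> : (s * t / r) ^+ 2 = s ^+ 2 * t ^+ 2 / r ^+ 2 by field; rewrite gt_eqF.
rewrite r2; field; by rewrite !gt_eqF.
Qed.

Lemma heat_EFin s u (M x : R) : 0 < s -> measurable_fun setT u ->
  (forall y, `|u y| <= M) ->
  ((heat s u x)%:E = \int[mu]_y (u y * normal_pdf x s y)%:E)%E.
Proof.
move=> s0 mu0 uM; have I := integrable_heat x s0 mu0 uM.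
rewrite /heat /gauss_avg /Rintegral fineK; last exact: (integrable_fin_num _ I).
by apply: eq_integral => y _; rewrite mulr1.
Qed.

(** Tonelli's theorem exchanges the integrals; by [normal_pdf_mul] the inner one is then that of a
    conditional density, equal to 1. *)
Lemma heat_semigroup s t u x : 0 < s -> 0 < t -> measurable_fun setT u ->
  (forall y, 0 <= u y <= 1) ->
  heat s (heat t u) x = heat (Num.sqrt (s ^+ 2 + t ^+ 2)) u x.
Proof.
move=> s0 t0 mu0 u01; set r := Num.sqrt _.
have st0 : 0 < s ^+ 2 + t ^+ 2 by rewrite addr_gt0// exprn_gt0.
have r0 : 0 < r by rewrite sqrtr_gt0.
have uM y : `|u y| <= 1 by rewrite ler_norml; have := u01 y; lra.
have u0 y : 0 <= u y by have /andP[] := u01 y.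
have hM y : `|heat t u y| <= 1.
  by rewrite ler_norml; have := heat_itv y t0 mu0 u01; lra.
have mh : measurable_fun setT (heat t u).
  by apply: continuous_measurable_fun; exact: (continuous_heat t0 mu0 uM).
apply: EFin_inj; rewrite (heat_EFin x s0 mh hM) (heat_EFin x r0 mu0 uM).
pose F (z : R * R) := (u z.2 * normal_pdf z.1 t z.2 * normal_pdf x s z.1)%:E.
have mF : measurable_fun setT F.
  apply/measurable_EFinP; apply: measurable_funM; last first.
    by apply: measurableT_comp => //; exact: measurable_normal_pdf.
  apply: measurable_funM; first exact: measurableT_comp.
  under eq_fun => z do rewrite normal_pdfE ?gt_eqF//.
  apply: measurable_funM => //; rewrite /normal_fun.
  apply: measurableT_comp => //; apply: measurable_funM => //.
  apply: measurableT_comp => //; apply: measurable_funX.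
  exact: measurable_funB.
have F0 z : (0 <= F z)%E by rewrite lee_fin !mulr_ge0// normal_pdf_ge0.
transitivity (\int[mu]_w \int[mu]_y F (w, y))%E.
  apply: eq_integral => w _.
  rewrite EFinM (heat_EFin w t0 mu0 uM) -ge0_integralZr//.
  - apply/measurable_EFinP; apply: measurable_funM => //.
    exact: measurable_normal_pdf.
  - by move=> y _; rewrite lee_fin mulr_ge0// normal_pdf_ge0.
  - by rewrite lee_fin normal_pdf_ge0.
have -> : (\int[mu]_w \int[mu]_y F (w, y) = \int[mu]_y \int[mu]_w F (w, y))%E.
  exact: (@fubini_tonelli _ _ _ _ R mu mu F mF F0).
apply: eq_integral => y _ /=.
transitivity (\int[mu]_w ((u y * normal_pdf x r y)%:E *
  (normal_pdf ((t ^+ 2 * x + s ^+ 2 * y) / r ^+ 2) (s * t / r) w)%:E))%E.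
  apply: eq_integral => w _; have E := normal_pdf_mul x y w s0 t0.
  by rewrite /= -/r in E; rewrite /F/= -mulrA E mulrA EFinM.
rewrite ge0_integralZl//.
- by rewrite integral_normal_pdf mule1.
- by apply/measurable_EFinP; exact: measurable_normal_pdf.
- by move=> w _; rewrite lee_fin normal_pdf_ge0.
- by rewrite lee_fin mulr_ge0// normal_pdf_ge0.
Qed.

End heat.

(** * The smoothed test functions *)

Section smoothing_family.
Context {R : realType}.

Definition rem_sd (n j : nat) : R := Num.sqrt (j%:R / n%:R).

(* The cutoff controls the third derivative for a small remaining variance, the Gaussian kernel for a larger one. *)
Definition third_bound (e : R) (n j : nat) : R :=
  if rem_sd n j <= e / 4 then 108 / e ^+ 3 else 49 / 40 / rem_sd n j ^+ 3.

Lemma rem_sd_gt0 n j : (0 < n)%N -> (0 < j)%N -> 0 < rem_sd n j.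
Proof. by move=> n0 j0; rewrite sqrtr_gt0 divr_gt0// ltr0n. Qed.

Lemma rem_sd_sqr n j : rem_sd n j ^+ 2 = j%:R / n%:R.
Proof. by rewrite sqr_sqrtr// divr_ge0. Qed.

Lemma third_bound_ge0 e n j : 0 < e -> 0 <= third_bound e n j.
Proof.
move=> e0; rewrite /third_bound; case: ifP => _.
  by rewrite divr_ge0// exprn_ge0// ltW.
by rewrite !divr_ge0// exprn_ge0// sqrtr_ge0.
Qed.

(** For [x] and [y] the square roots of consecutive multiples of [1 / N], this bounds a term of the
    series of [(j/n)^(-3/2)] by a telescoping difference. *)
Lemma inv_cube_le (x y N : R) : 0 < x -> x < y -> N * (y ^+ 2 - x ^+ 2) = 1 ->
  (y ^+ 3)^-1 <= 2 * N * (x^-1 - y^-1).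
Proof.
move=> x0 xy NE; have y0 := lt_trans x0 xy.
have xy0 : 0 < x * y * (x + y) by rewrite !mulr_gt0// addr_gt0.
have -> : 2 * N * (x^-1 - y^-1) = 2 * (N * (y ^+ 2 - x ^+ 2)) / (x * y * (x + y)).
  by field; rewrite !gt_eqF// addr_gt0.
rewrite NE mulr1 -[leLHS]mul1r ler_pdivrMr ?exprn_gt0// mulrAC ler_pdivlMr//.
have : 0 <= (y - x) * (2 * y + x) * y by rewrite !mulr_ge0//; lra.
lra.
Qed.

(** The bound changes form at [j = tau = n * e ^+ 2 / 16]. The at most [tau + 1] small indices cost
    [108 / e ^+ 3] each, the first large one at most [B * (4 / e) ^+ 3], and the others telescope to
    at most [2 * B * n * (4 / e)]. In total [n / e] has coefficient 27/4 + 49/5 = 331/20, and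
    [1 / e ^+ 3] has 108 + 392/5 < 187. *)
Lemma sum_third_bound e n : 0 < e -> (0 < n)%N ->
  \sum_(j < n) third_bound e n j <= n%:R * (331 / 20 / e) + 187 / e ^+ 3.
Proof.
move=> e0 n0; have N0 : 0 < n%:R :> R by rewrite ltr0n.
pose a := 108 / e ^+ 3; pose B : R := 49 / 40.
have a0 : 0 < a by rewrite divr_gt0// exprn_gt0.
have e3 : 0 < e ^+ 3 by rewrite exprn_gt0.
pose tau := n%:R * e ^+ 2 / 16.
have tau0 : 0 < tau by rewrite !mulr_gt0// ?invr_gt0// exprn_gt0.
have sm j : (rem_sd n j <= e / 4) = (j%:R <= tau).
  rewrite -(@ler_pXn2r _ 2)// ?nnegrE ?sqrtr_ge0 ?divr_ge0 ?(ltW e0)//.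
  rewrite rem_sd_sqr ler_pdivrMr// /tau; congr (_ <= _); by field.
pose V := (tau + 1) * a + B * (4 / e) ^+ 3 + 2 * B * n%:R * (4 / e).
have VE : V <= n%:R * (331 / 20 / e) + 187 / e ^+ 3.
  rewrite -subr_ge0 (_ : _ - _ = 3 / 5 / e ^+ 3).
    by rewrite divr_ge0 ?ltW.
  by rewrite /V /tau /a /B; field; rewrite gt_eqF.
apply: le_trans VE.
have small m : m%:R <= tau + 1 -> \sum_(j < m) third_bound e n j <= m%:R * a.
  elim: m => [|m IH] mt; first by rewrite big_ord0 mul0r.
  rewrite big_ord_recr/= -natr1 mulrDl mul1r lerD//.
    by apply: IH; rewrite -natr1 in mt; lra.
  by rewrite /third_bound sm; case: ifP => //; rewrite -natr1 in mt; lra.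
have B0 : 0 < B by rewrite /B; lra.
(* The added term [2 * B * n / rem_sd n m] is a potential whose decrease pays for each new
   summand. *)
have large m : tau < m%:R ->
    \sum_(j < m.+1) third_bound e n j + 2 * B * n%:R / rem_sd n m <= V.
  elim: m => [|m IH] tm; first by move: tm; rewrite ltNge ltW.
  have s1 : e / 4 < rem_sd n m.+1 by rewrite ltNge sm -ltNge.
  have s10 : 0 < rem_sd n m.+1 by rewrite (lt_trans _ s1)// divr_gt0.
  have tbE : third_bound e n m.+1 = B * (rem_sd n m.+1 ^+ 3)^-1.
    by rewrite /third_bound leNgt s1.
  rewrite big_ord_recr [X in _ + X + _]tbE.
  have [tm'|tm'] := ltP tau m%:R.
    have s2 : e / 4 < rem_sd n m by rewrite ltNge sm -ltNge.
    have s20 : 0 < rem_sd n m by rewrite (lt_trans _ s2)// divr_gt0.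
    have s12 : rem_sd n m < rem_sd n m.+1.
      by rewrite ltr_sqrt ?divr_gt0// ltr_pM2r ?invr_gt0// ltr_nat.
    have := inv_cube_le (N := n%:R) s20 s12 _.
    rewrite !rem_sd_sqr -mulrBl -(natrB _ (leqnSn m)) subSnn mul1r divff ?gt_eqF//.
    move=> /(_ erefl) H; have := IH tm'.
    have : B * (rem_sd n m.+1 ^+ 3)^-1 <= B * (2 * n%:R * ((rem_sd n m)^-1 - (rem_sd n m.+1)^-1)).
      by rewrite ler_pM2l.
    by move: (\sum_(j < _) _) => S; lra.
  (* Here [m <= tau < m + 1]: the first large index, where both its summand and the initial
     potential are bounded by their values at the threshold [e / 4]. *)
  have i1 : (rem_sd n m.+1)^-1 <= 4 / e.
    by rewrite -[leRHS]invf_div lef_pV2 ?posrE ?divr_gt0// ltW.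
  have i3 : (rem_sd n m.+1 ^+ 3)^-1 <= (4 / e) ^+ 3.
    rewrite -exprVn; apply: lerXn2r; rewrite ?nnegrE//; first by rewrite invr_ge0 ltW.
    by rewrite divr_ge0 // ltW.
  have h1 : m.+1%:R <= tau + 1 by rewrite -natr1; lra.
  have := small _ h1.
  have : m.+1%:R * a <= (tau + 1) * a by rewrite ler_pM2r.
  have : B * (rem_sd n m.+1 ^+ 3)^-1 <= B * (4 / e) ^+ 3 by rewrite ler_pM2l.
  have : 2 * B * n%:R * (rem_sd n m.+1)^-1 <= 2 * B * n%:R * (4 / e).
    by rewrite ler_pM2l// !mulr_gt0.
  by rewrite /V; move: (\sum_(j < _) _) => S; lra.
have [nt|nt] := leP n%:R (tau + 1).
  apply: le_trans (small _ nt) _; rewrite /V -addrA ler_wpDr//.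
    have e40 : 0 <= 4 / e by rewrite divr_ge0// ltW.
    have BB := ltW B0.
    by apply: addr_ge0; repeat apply: mulr_ge0 => //.
  by rewrite ler_pM2r.
case: n n0 N0 @tau tau0 sm @V small large nt => // n n0 N0 tau tau0 sm V small large nt.
have tn : tau < n%:R by rewrite -natr1 in nt; lra.
apply: le_trans (large _ tn); rewrite lerDl !mulr_ge0 ?invr_ge0 ?sqrtr_ge0//.
Qed.

Lemma measurable_enlargement (A : set R) (e : R) : measurable (enlargement A e).
Proof.
apply: open_measurable.
have -> : enlargement A e = \bigcup_(y in A) ball y e.
  apply/seteqP; split=> x /= [y Ay xy]; exists y => //.
    by rewrite /ball/= distrC.
  by move: xy; rewrite /ball/= distrC.
by apply: bigcup_open => y _; exact: ball_open.
Qed.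

(* [v j] is the test function smoothed by the variance of the [j] remaining steps. *)
Lemma smoothing_family (A : set R) (e : R) (n : nat) : 0 < e -> (0 < n)%N ->
  exists v p q : nat -> R -> R,
  [/\ forall j x, 0 <= v j x <= 1,
      forall j, [/\ continuous (v j), continuous (p j) & continuous (q j)],
      forall j, (j < n)%N -> taylor3 (third_bound e n j) (v j) (p j) (q j),
      forall j x, v j x + q j x * n%:R^-1 / 2 -
        third_bound e n j / 6 * (7 / 4 * (Num.sqrt n%:R)^-1 ^+ 3) <= v j.+1 x &
      (forall x, A x -> v 0%N x = 1) /\
      ((v n 0)%:E <= normal_prob 0 1 (enlargement A e))%E].
Proof.
move=> e0 n0; have N0 : 0 < n%:R :> R by rewrite ltr0n.
have [u [u1 [u2 [du1 du2 u2L u01 [uA uAe]]]]] := smooth_cutoff A e0.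
have cu := is_derive_continuous du1; have cu1 := is_derive_continuous du2.
have cu2 : continuous u2.
  have L0 : 0 < 108 / e ^+ 3 by rewrite divr_gt0// exprn_gt0.
  move=> x; apply/cvgrPdist_le => d d0; near=> y.
  apply: le_trans (u2L _ _) _.
  rewrite mulrC -ler_pdivlMr//; near: y.
  by apply: cvgr_dist_le; [exact: cvg_id|exact: divr_gt0].
have [M [u1M u2M]] : exists M, (forall x, `|u1 x| <= M) /\ (forall x, `|u2 x| <= M).
  pose K := 18 / e ^+ 2.
  have K2 x : `|u2 x| <= K by have [] := u01 x.
  have K0 : 0 <= K := le_trans (normr_ge0 _) (K2 0).
  exists (1 + K + 54 / e ^+ 3 + K) ; split=> x.
    (* Taylor's inequality with increment 1 bounds [u1] through the bounds on [u] and [u2]. *)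
    have := taylor3_of_derive du1 du2 u2L x 1.
    have [/andP[? ?] _] := u01 x; have [/andP[? ?] _] := u01 (x + 1).
    have := K2 x; have : 0 <= 54 / e ^+ 3 by rewrite divr_ge0// exprn_ge0// ltW.
    rewrite normr1 !expr1n !mulr1 !ler_norml => ? /andP[? ?] /andP[? ?].
    by apply/andP; split; lra.
  apply: le_trans (K2 x) _; rewrite lerDr !addr_ge0//.
  by rewrite divr_ge0// exprn_ge0// ltW.
have u01' x : 0 <= u x <= 1 by have [] := u01 x.
have uM x : `|u x| <= 1 by rewrite ler_norml; have := u01' x; lra.
have mc (f : R -> R) : continuous f -> measurable_fun setT f := @continuous_measurable_fun _ f.
have T0 : taylor3 (108 / e ^+ 3) u u1 u2 by exact: taylor3_of_derive.
pose s j := rem_sd n j.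
have s0 j : (0 < j)%N -> 0 < s j by exact: rem_sd_gt0.
pose v j := if j == 0%N then u else heat (s j) u.
pose H j k := gauss_avg (s j) u (hermite (s j ^+ 2)^-1 k).
(* The branches follow [third_bound]: for a small remaining variance the derivatives fall on [u],
   otherwise on the kernel. At [j = 0] the kernel degenerates and [u] itself is used. *)
pose p j := if j == 0%N then u1 else
  if s j <= e / 4 then heat (s j) u1 else H j 1.
pose q j := if j == 0%N then u2 else
  if s j <= e / 4 then heat (s j) u2 else H j 2.
have v01 j x : 0 <= v j x <= 1.
  by rewrite /v; case: j => [|j]//=; apply: heat_itv => //; [exact: s0|exact: mc].
have vc j : [/\ continuous (v j), continuous (p j) & continuous (q j)].
  rewrite /v /p /q; case: j => [|j]//=.
  have cH k : continuous (H j.+1 k).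
    apply: is_derive_continuous => x.
    by apply: is_derive_gauss_hermite; [exact: s0|exact: mc|exact: uM].
  have ch (f : R -> R) N : continuous f -> (forall x, `|f x| <= N) -> continuous (heat (s j.+1) f).
    by move=> cf fN; apply: continuous_heat fN; [exact: s0|exact: mc].
  by case: ifP => _; split => //; apply: ch; eassumption.
have T j : taylor3 (third_bound e n j) (v j) (p j) (q j).
  rewrite /v /p /q /third_bound -/(s j); case: j => [|j].
    by rewrite /= ifT// /s /rem_sd mul0r sqrtr0 divr_ge0// ltW.
  rewrite /=; case: ifP => _.
    by apply: taylor3_heat cu cu1 cu2 _ u1M u2M T0 => //; [exact: s0|rewrite divr_ge0// exprn_ge0// ltW].
  by apply: taylor3_gauss_avg => //; [exact: s0|exact: mc].
exists v, p, q; split=> //.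
- move=> j x.
  have [cv _ _] := vc j.
  have vM y : `|v j y| <= 1 by rewrite ler_norml; have := v01 j y; lra.
  have n1 : 0 < (Num.sqrt n%:R)^-1 :> R by rewrite invr_gt0 sqrtr_gt0.
  have nu2 : (Num.sqrt n%:R)^-1 ^+ 2 = n%:R^-1 :> R.
    by rewrite exprVn sqr_sqrtr// ler0n.
  have := heat_ge_taylor3 x n1 (third_bound_ge0 n j e0) (mc _ cv) vM (T j).
  rewrite nu2 => /le_trans; apply.
  suff -> : v j.+1 x = heat (Num.sqrt n%:R)^-1 (v j) x by exact: lexx.
  (* Variances add, [1/n + k/n = (k+1)/n]: one Gaussian step of variance [1/n] leads from [v j] to
     [v j.+1]. *)
  have sS k : s k.+1 = Num.sqrt ((Num.sqrt n%:R)^-1 ^+ 2 + s k ^+ 2).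
    rewrite nu2 /s rem_sd_sqr /rem_sd; congr Num.sqrt.
    by rewrite -[k.+1%:R]natr1 mulrDl mul1r addrC.
  have [->|j0] := posnP j.
    have -> : v 1%N = heat (s 1%N) u by [].
    have -> : v 0%N = u by [].
    congr (heat _ u x); rewrite sS rem_sd_sqr mul0r addr0 sqrtr_sqr.
    by rewrite ger0_norm// ltW.
  have -> : v j.+1 = heat (s j.+1) u by [].
  have -> : v j = heat (s j) u by rewrite /v gtn_eqF.
  by rewrite (heat_semigroup x n1 (s0 j j0) (mc _ cu) u01') -sS.
- split=> //; rewrite /v gtn_eqF//.
  have -> : s n = 1 by rewrite /s /rem_sd divff ?sqrtr1// gt_eqF.
  rewrite (heat_EFin 0 ltr01 (mc _ cu) uM) /normal_prob [leRHS]integral_mkcond.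
  apply: ge0_le_integral => //.
  + by move=> y _; rewrite lee_fin mulr_ge0 ?normal_pdf_ge0//; have /andP[] := u01' y.
  + apply/measurable_EFinP/measurable_funM; first exact: mc.
    exact: measurable_normal_pdf.
  + apply/(measurable_restrictT _ _).1; first exact: measurable_enlargement.
    by apply/measurable_EFinP/measurable_funTS; exact: measurable_normal_pdf.
  + move=> y _; rewrite patchE; case: ifPn => [_|].
      by rewrite lee_fin ler_piMl ?normal_pdf_ge0//; have /andP[] := u01' y.
    move=> /negP yA; have [->|/uAe ya] := eqVneq (u y) 0; first by rewrite mul0r.
    by exfalso; apply: yA; rewrite inE.
Unshelve. all: by end_near. Qed.
End smoothing_family.

(** * Sublinear expectations and switching controls *)

Section sublinear.
Context {R : realType} {Omega : Type} (S : sublinear_space R Omega).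
Local Notation E := (upexp S).
Implicit Types (U V : Omega -> R).

Lemma upexpDc U (c : R) : rvs S U -> E (fun w => U w + c) = E U + c.
Proof.
move=> HU; apply/eqP; rewrite eq_le; apply/andP; split.
  by rewrite -[X in _ <= _ + X](upexp_cst S c) upexp_subadd//; exact: rvs_cst.
rewrite -lerBrDr.
have HUc : rvs S (fun w => U w + c) by apply: rvsD => //; exact: rvs_cst.
have := upexp_subadd HUc (rvs_cst S (- c)); rewrite !upexp_cst.
by rewrite (_ : (fun w => U w + c + - c) = U)//; apply/funext => w; rewrite addrK.
Qed.

Lemma lowexp_le_upexp U : rvs S U -> lowexp S U <= E U.
Proof.
move=> HU; rewrite /lowexp -subr_ge0 opprK -[leLHS](upexp_cst S 0).
have HN : rvs S (fun w => - U w).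
  by under eq_fun do rewrite -mulN1r; exact: rvsZ.
have := upexp_subadd HU HN.
by under eq_fun do rewrite subrr.
Qed.

Lemma upexpZ_le0 (c : R) U : c <= 0 -> rvs S U ->
  E (fun w => c * U w) = c * lowexp S U.
Proof.
move=> c0 HU; rewrite /lowexp mulrN -mulNr -upexp_homog ?oppr_ge0//.
  by congr E; apply/funext => w; rewrite mulrNN.
by under eq_fun do rewrite -mulN1r; exact: rvsZ.
Qed.

(** Subadditivity makes the upper expectation Lipschitz in a coefficient. The continuity of the
    controls rests on this. *)
Lemma upexp_lin_le U V (a b : R) : rvs S U -> rvs S V -> 
  E (fun w => U w + a * V w) - E (fun w => U w + b * V w) <=
  (`|E V| + `|lowexp S V|) * `|a - b|.
Proof.
move=> HU HV.
have HbV : rvs S (fun w => U w + b * V w) by apply: rvsD => //; exact: rvsZ.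
have HabV : rvs S (fun w => (a - b) * V w) by exact: rvsZ.
have := upexp_subadd HbV HabV.
have -> : (fun w => U w + b * V w + (a - b) * V w) = (fun w => U w + a * V w).
  by apply/funext => w; ring.
suff : E (fun w => (a - b) * V w) <= (`|E V| + `|lowexp S V|) * `|a - b| by lra.
have [ab|/ltW ab] := leP 0 (a - b).
  rewrite upexp_homog// mulrC (ger0_norm ab) ler_wpM2r//.
  by rewrite (le_trans (ler_norm _))// lerDl.
rewrite upexpZ_le0// (ler0_norm ab) -mulrNN mulrC ler_wpM2r ?oppr_ge0//.
by rewrite (le_trans (ler_norm _))// normrN lerDr.
Qed.

Lemma upexp_lin_continuous U V : rvs S U -> rvs S V ->
  continuous (fun a : R => E (fun w => U w + a * V w)).
Proof.
move=> HU HV a; set K := `|E V| + `|lowexp S V|.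
have K1 : 0 < K + 1 by rewrite ltr_wpDl// addr_ge0.
apply/cvgrPdist_le => d d0; near=> b.
apply: (@le_trans _ _ (K * `|a - b|)).
  have := upexp_lin_le a b HU HV; have := upexp_lin_le b a HU HV.
  rewrite -/K (distrC b) ler_norml => ? ?; apply/andP; split; lra.
apply: (@le_trans _ _ ((K + 1) * `|a - b|)); first by rewrite ler_wpM2r// lerDl.
rewrite mulrC -ler_pdivlMr//; near: b.
by apply: cvgr_dist_le; [exact: cvg_id|exact: divr_gt0].
Unshelve. all: by end_near. Qed.

Section one_variable.
Variable X0 : Omega -> R.
Hypotheses (hX0 : rvs S X0) (hX0sq : rvs S (fun w => X0 w ^+ 2)).

Lemma rvs_centered_sqr (m : R) : rvs S (fun w => (X0 w - m) ^+ 2).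
Proof.
have -> : (fun w => (X0 w - m) ^+ 2) =
    (fun w => X0 w ^+ 2 + (- 2 * m) * X0 w + m ^+ 2).
  by apply/funext => w; ring.
apply: rvsD; last exact: rvs_cst.
by apply: rvsD => //; exact: rvsZ.
Qed.

(** Expanding the square leaves [m] as a linear coefficient inside the expectation, plus the
    constant [a * m ^+ 2]. The cases [a = 1] and [a = -1] give the upper and the lower variance. *)
Lemma upexp_centered_sqr_continuous (a : R) :
  continuous (fun m : R => E (fun w => a * (X0 w - m) ^+ 2)).
Proof.
have H1 : rvs S (fun w => a * X0 w ^+ 2) by exact: rvsZ.
have H2 : rvs S (fun w => - 2 * a * X0 w) by exact: rvsZ.
have -> : (fun m => E (fun w => a * (X0 w - m) ^+ 2)) =
    (fun m => E (fun w => a * X0 w ^+ 2 + m * (- 2 * a * X0 w)) + a * m ^+ 2).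
  apply/funext => m; rewrite -upexpDc; last by apply: rvsD => //; exact: rvsZ.
  by congr E; apply/funext => w; ring.
move=> m; apply: cvgD; first exact: upexp_lin_continuous.
apply: cvgM; first exact: cvg_cst.
exact: exprn_continuous.
Qed.

Lemma up_sd_at_continuous : continuous (up_sd_at S X0).
Proof.
move=> m; rewrite /up_sd_at.
apply: (@cvg_comp _ _ _ (fun m => E (fun w => (X0 w - m) ^+ 2)) Num.sqrt);
  last exact: sqrt_continuous.
have := @upexp_centered_sqr_continuous 1.
rewrite (_ : (fun _ => _) = (fun z : R => E (fun w => (X0 w - z) ^+ 2))); first exact.
by apply/funext => z; congr (E _); apply/funext => w; rewrite mul1r.
Qed.

Lemma low_sd_at_continuous : continuous (low_sd_at S X0).
Proof.
move=> m; rewrite /low_sd_at /lowexp.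
apply: (@cvg_comp _ _ _ (fun m => - E (fun w => - (X0 w - m) ^+ 2)) Num.sqrt);
  last exact: sqrt_continuous.
apply: cvgN.
have := @upexp_centered_sqr_continuous (- 1).
rewrite (_ : (fun _ => _) = (fun z : R => E (fun w => - (X0 w - z) ^+ 2))); first exact.
by apply/funext => z; congr (E _); apply/funext => w; rewrite mulN1r.
Qed.

Lemma low_sd_at_le m : low_sd_at S X0 m <= up_sd_at S X0 m.
Proof. by rewrite ler_wsqrtr// lowexp_le_upexp//; exact: rvs_centered_sqr. Qed.

Lemma low_mean_le : low_mean S X0 <= up_mean S X0.
Proof. exact: lowexp_le_upexp. Qed.

Lemma upexp_centered (c m : R) : E (fun w => c * (X0 w - m)) =
  if 0 <= c then c * (up_mean S X0 - m) else c * (low_mean S X0 - m).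
Proof.
have -> : (fun w => c * (X0 w - m)) = (fun w => c * X0 w + (- (c * m))).
  by apply/funext => w; ring.
rewrite upexpDc; last exact: rvsZ.
case: ifPn => c0; first by rewrite upexp_homog// mulrBr.
by rewrite upexpZ_le0// ?mulrBr// ltW// ltNge.
Qed.

(** Positivity of [low_sd_at] ensures that its square is the lower variance, since [Num.sqrt] sends
    negative numbers to 0. *)
Lemma upexp_centered_var (c m r : R) : 0 < low_sd_at S X0 m ->
  E (fun w => c * ((X0 w - m) ^+ 2 - r)) =
  if 0 <= c then c * (up_sd_at S X0 m ^+ 2 - r)
  else c * (low_sd_at S X0 m ^+ 2 - r).
Proof.
move=> s0; have H := rvs_centered_sqr m.
have l0 : 0 <= lowexp S (fun w => (X0 w - m) ^+ 2).
  by rewrite ltW// -sqrtr_gt0.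
have -> : (fun w => c * ((X0 w - m) ^+ 2 - r)) =
    (fun w => c * (X0 w - m) ^+ 2 + (- (c * r))).
  by apply/funext => w; ring.
rewrite upexpDc; last exact: rvsZ.
rewrite !sqr_sqrtr//; last exact: le_trans (lowexp_le_upexp H).
case: ifPn => c0; first by rewrite upexp_homog// mulrBr.
by rewrite upexpZ_le0// ?mulrBr// ltW// ltNge.
Qed.

(** A continuous substitute for the indicator of [p >= 0], with a linear transition on [[-d, d]]:
    the class of controls admits only continuous functions of the walk. *)
Definition switch (d p : R) : R := clamp01 ((p / d + 1) / 2).

Lemma switch_itv d p : 0 <= switch d p <= 1. Proof. exact: clamp01_itv. Qed.

Lemma switch_continuous d : continuous (switch d).
Proof.
have cc : continuous (@clamp01 R).
  move=> x; apply/cvgrPdist_le => e e0; near=> y.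
  apply: le_trans (clamp01_lip _ _) _; near: y.
  by apply: cvgr_dist_le; [exact: cvg_id|].
move=> x; apply: (@cvg_comp _ _ _ (fun p => (p / d + 1) / 2) (@clamp01 R)); last exact: cc.
apply: cvgM; last exact: cvg_cst.
apply: cvgD; last exact: cvg_cst.
by apply: cvgM; [exact: cvg_id|exact: cvg_cst].
Unshelve. all: by end_near. Qed.

(** A wrong weight occurs only for [p] at most [d], where it costs at most [d]; beyond [d] the
    switch is exact. *)
Lemma switch_ge0 d p : 0 < d -> 0 <= p -> p * (1 - switch d p) <= d.
Proof.
move=> d0 p0; have [pd|/ltW pd] := leP p d.
  have /andP[s0 s1] := switch_itv d p.
  rewrite -[leRHS]mulr1 ler_pM//; lra.
have : 1 <= (p / d + 1) / 2.
  by have : 1 <= p / d by [rewrite ler_pdivlMr// mul1r]; lra.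
rewrite /switch; case: (clamp01P ((p / d + 1) / 2)) => -[h ->] ?; try lra.
by rewrite (_ : (_ + _) / 2 = 1) ?subrr ?mulr0 ?(ltW d0)//; lra.
Qed.

Lemma switch_le0 d p : 0 < d -> p <= 0 -> - p * switch d p <= d.
Proof.
move=> d0 p0; have [pd|/ltW pd] := leP (- p) d.
  have /andP[s0 s1] := switch_itv d p.
  rewrite -[leRHS]mulr1 ler_pM//; lra.
have : (p / d + 1) / 2 <= 0.
  by have : p / d <= - 1 by [rewrite ler_pdivrMr// mulN1r; lra]; lra.
rewrite /switch; case: (clamp01P ((p / d + 1) / 2)) => -[h ->] ?; try lra.
by rewrite (_ : (_ + _) / 2 = 0) ?mulr0 ?(ltW d0)//; lra.
Qed.

Definition switch_mean (d p : R) : R :=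
  low_mean S X0 + switch d p * (up_mean S X0 - low_mean S X0).

Definition switch_sd (d m q : R) : R :=
  low_sd_at S X0 m + switch d q * (up_sd_at S X0 m - low_sd_at S X0 m).

Lemma switch_mean_itv d p : low_mean S X0 <= switch_mean d p <= up_mean S X0.
Proof.
have /andP[s0 s1] := switch_itv d p; have := low_mean_le.
rewrite /switch_mean -subr_ge0 => D0; have := mulr_ge0 s0 D0.
have s1' : 0 <= 1 - switch d p by rewrite subr_ge0.
have := mulr_ge0 s1' D0; lra.
Qed.

Lemma switch_sd_itv d m q :
  low_sd_at S X0 m <= switch_sd d m q <= up_sd_at S X0 m.
Proof.
have /andP[s0 s1] := switch_itv d q; have := low_sd_at_le m.
rewrite /switch_sd -subr_ge0 => D0; have := mulr_ge0 s0 D0.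
have s1' : 0 <= 1 - switch d q by rewrite subr_ge0.
have := mulr_ge0 s1' D0; lra.
Qed.

Lemma switch_mean_drift d p k : 0 < d -> 0 <= k ->
  E (fun w => k * p * (X0 w - switch_mean d p)) <=
  k * d * (up_mean S X0 - low_mean S X0).
Proof.
move=> d0; rewrite le_eqVlt => /predU1P[<-|k0].
  by under eq_fun do rewrite !mul0r; rewrite upexp_cst !mul0r.
have D0 : 0 <= up_mean S X0 - low_mean S X0 by rewrite subr_ge0 low_mean_le.
rewrite upexp_centered pmulr_rge0// /switch_mean; case: ifPn => [p0|].
  rewrite (_ : k * p * _ = k * (p * (1 - switch d p)) * (up_mean S X0 - low_mean S X0)); last ring.
  by rewrite ler_wpM2r// ler_pM2l// switch_ge0.
rewrite -ltNge => /ltW p0.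
rewrite (_ : k * p * _ = k * (- p * switch d p) * (up_mean S X0 - low_mean S X0)); last ring.
by rewrite ler_wpM2r// ler_pM2l// switch_le0.
Qed.

(** With [a <= s <= b] the lower, chosen and upper deviations, [b ^+ 2 - s ^+ 2] is [1 - switch]
    times [(b - a) * (b + s)], and [a ^+ 2 - s ^+ 2] is minus [switch] times [(b - a) * (a + s)].
    Either way the sign of [q] meets the matching estimate on the switch. *)
Lemma switch_sd_var d m q k : 0 < d -> 0 <= k -> 0 < low_sd_at S X0 m ->
  E (fun w => k * q * ((X0 w - m) ^+ 2 - switch_sd d m q ^+ 2)) <=
  k * d * (2 * up_sd_at S X0 m ^+ 2).
Proof.
move=> d0 + s0; rewrite le_eqVlt => /predU1P[<-|k0].
  by under eq_fun do rewrite !mul0r; rewrite upexp_cst !mul0r.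
have := low_sd_at_le m; rewrite -subr_ge0 => D0.
have /andP[h1 h2] := switch_sd_itv d m q.
rewrite upexp_centered_var// pmulr_rge0//.
set s := switch_sd d m q; set a := low_sd_at S X0 m; set b := up_sd_at S X0 m.
have a0 : 0 < a by [].
have K : (b - a) * (2 * b) <= 2 * b ^+ 2.
  by have := mulr_ge0 (ltW a0) (le_trans (ltW a0) (low_sd_at_le m)); rewrite -/b; lra.
have dk : 0 < k * d by rewrite mulr_gt0.
apply: le_trans (_ : k * d * ((b - a) * (2 * b)) <= _); last by rewrite ler_pM2l.
have ba : 0 <= b - a := D0.
have as_ : a <= s := h1.
have sb : s <= b := h2.
case: ifPn => [q0|].
  have -> : k * q * (b ^+ 2 - s ^+ 2) = k * (q * (1 - switch d q)) * ((b - a) * (b + s)).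
    by rewrite /s /switch_sd -/a -/b; ring.
  apply: ler_pM.
  - rewrite !mulr_ge0 ?(ltW k0)//; have := switch_itv d q; lra.
  - apply: mulr_ge0 => //; lra.
  - by rewrite ler_pM2l// switch_ge0.
  - by rewrite ler_wpM2l//; lra.
rewrite -ltNge => /ltW q0.
have -> : k * q * (a ^+ 2 - s ^+ 2) = k * (- q * switch d q) * ((b - a) * (a + s)).
  by rewrite /s /switch_sd -/a -/b; ring.
apply: ler_pM.
- rewrite !mulr_ge0 ?(ltW k0) ?oppr_ge0//; have := switch_itv d q; lra.
- apply: mulr_ge0 => //; lra.
- by rewrite ler_pM2l// switch_le0.
- by rewrite ler_wpM2l//; lra.
Qed.

End one_variable.
End sublinear.

(** * The controlled walk *)

Section iteration.
Context {R : realType} {Omega : Type} (S : sublinear_space R Omega).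
Local Notation E := (upexp S).

Lemma bounded_fun01 (T : Type) (f : T -> R) : (forall x, 0 <= f x <= 1) -> bounded_fun f.
Proof.
move=> f01; exists 1; split => // M M1 x _.
by rewrite /= ler_norml; have := f01 x => /andP[? ?]; apply/andP; split; lra.
Qed.

(** One replacement step. The Taylor expansion splits into a linear term [A], a quadratic term [B]
    centred at the chosen variance and a cubic term [C], estimated separately by subadditivity; the
    centring of [B] leaves the Gaussian contribution [q x * nu ^+ 2 / 2]. The majorant [Y] stands
    for the third absolute moment, which may lie outside the space. *)
Lemma switch_step (X0 Xk Y : Omega -> R) (u p q : R -> R)
    (L x d m sg nu s_ sU : R) :
  rvs S X0 -> rvs S (fun w => X0 w ^+ 2) -> same_distribution S Xk X0 ->
  rvs S Y -> (forall w, `|(X0 w - m) / low_sd_at S X0 m| ^+ 3 <= Y w) ->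
  (forall y, 0 <= u y <= 1) -> continuous u -> taylor3 L u p q -> 0 <= L ->
  0 < d -> 0 < nu -> 0 < s_ -> s_ <= low_sd_at S X0 m -> up_sd_at S X0 m <= sU ->
  m = switch_mean S X0 d (p x) -> sg = switch_sd S X0 d m (q x) ->
  E (fun w => u (x + nu * ((Xk w - m) / sg))) <=
  u x + q x * nu ^+ 2 / 2 + L / 6 * nu ^+ 3 * E Y +
  d * (nu / s_ * (up_mean S X0 - low_mean S X0) + nu ^+ 2 / s_ ^+ 2 * sU ^+ 2).
Proof.
move=> hX hX2 sd hY YX u01 cu T L0 d0 nu0 s_0 s_l uU mE sgE.
have l0 : 0 < low_sd_at S X0 m by exact: lt_le_trans s_l.
have /andP[lsg sgu] : low_sd_at S X0 m <= sg <= up_sd_at S X0 m.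
  by rewrite sgE; exact: switch_sd_itv.
have sg0 : 0 < sg by exact: lt_le_trans lsg.
have s_sg : s_ <= sg by exact: le_trans lsg.
pose psi y := u (x + nu * ((y - m) / sg)).
have bpsi : bounded_continuous psi.
  split; first by apply: bounded_fun01 => y; exact: u01.
  move=> y; apply: (@cvg_comp _ _ _ (fun y => x + nu * ((y - m) / sg)) u); last exact: cu.
  apply: cvgD; first exact: cvg_cst.
  apply: cvgM; first exact: cvg_cst.
  apply: cvgM; last exact: cvg_cst.
  by apply: cvgB; [exact: cvg_id|exact: cvg_cst].
(* The passage to [X0] precedes the expansion: identity of law concerns bounded functions, whereas
   the unbounded Taylor terms are known to lie in the space for [X0]. *)
have [_ rp ->] := sd psi bpsi.
pose c1 := nu / sg; pose c2 := nu ^+ 2 / (2 * sg ^+ 2).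
have c10 : 0 <= c1 by rewrite divr_ge0 ?(ltW nu0)// ltW.
have c20 : 0 <= c2.
  by apply: divr_ge0; [exact: sqr_ge0|apply: mulr_ge0 => //; exact: sqr_ge0].
pose A w := c1 * p x * (X0 w - m).
pose B w := c2 * q x * ((X0 w - m) ^+ 2 - sg ^+ 2).
pose C w := L / 6 * nu ^+ 3 * Y w.
pose k := u x + q x * nu ^+ 2 / 2.
have cY0 : 0 <= L / 6 * nu ^+ 3.
  by apply: mulr_ge0; [exact: divr_ge0|rewrite exprn_ge0// ltW].
have rA : rvs S A by apply: rvsZ; apply: rvsD => //; exact: rvs_cst.
have rB : rvs S B.
  by apply: rvsZ; apply: rvsD; [exact: rvs_centered_sqr|exact: rvs_cst].
have rC : rvs S C by exact: rvsZ.
have rAB : rvs S (fun w => A w + B w) by exact: rvsD.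
have rABC : rvs S (fun w => A w + B w + C w) by exact: rvsD.
have EA : E A <= c1 * d * (up_mean S X0 - low_mean S X0).
  by rewrite /A mE; exact: switch_mean_drift.
have EB : E B <= c2 * d * (2 * up_sd_at S X0 m ^+ 2).
  by rewrite /B sgE; exact: switch_sd_var.
have EC : E C = L / 6 * nu ^+ 3 * E Y by exact: upexp_homog.
have EABC : E (fun w => A w + B w + C w + k) <= E A + E B + E C + k.
  rewrite upexpDc// lerD2r.
  by apply: le_trans (upexp_subadd rAB rC) _; rewrite lerD2r; exact: upexp_subadd.
apply: (@le_trans _ _ (E (fun w => A w + B w + C w + k))).
  apply: upexp_mono => //; first by apply: rvsD => //; exact: rvs_cst.
  move=> w; rewrite /psi.
  have := T x (nu * ((X0 w - m) / sg)); set h := nu * _.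
  have hY3 : `|h| ^+ 3 <= nu ^+ 3 * Y w.
    rewrite /h normrM exprMn (ger0_norm (ltW nu0)) ler_pM2l ?exprn_gt0//.
    apply: le_trans (YX w); apply: lerXn2r; rewrite ?nnegrE//.
    rewrite !normrM ler_wpM2l// !normfV lef_pV2 ?posrE ?normr_gt0 ?gt_eqF//.
    by rewrite (gtr0_norm l0) (gtr0_norm sg0).
  have := ler_wpM2l (_ : 0 <= L / 6) hY3; rewrite divr_ge0// => /(_ isT) hL.
  rewrite ler_norml => /andP[_ hT].
  have hA : A w = p x * h by rewrite /A /h /c1; field; rewrite gt_eqF.
  have hB : B w = q x * h ^+ 2 / 2 - q x * nu ^+ 2 / 2.
    by rewrite /B /h /c2; field; rewrite gt_eqF.
  rewrite hA hB /C /k; move: hT hL; clear; rewrite /= -/h; move: (u (x + h)) => v; lra.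
apply: le_trans EABC _; rewrite EC /k.
have D0 : 0 <= up_mean S X0 - low_mean S X0 by rewrite subr_ge0 low_mean_le.
have EA' : E A <= d * (nu / s_ * (up_mean S X0 - low_mean S X0)).
  apply: le_trans EA _; rewrite mulrAC mulrC ler_pM2l// ler_wpM2r//.
  by rewrite /c1 ler_pM2l// lef_pV2 ?posrE.
have EB' : E B <= d * (nu ^+ 2 / s_ ^+ 2 * sU ^+ 2).
  apply: le_trans EB _; rewrite mulrAC mulrC ler_pM2l//.
  rewrite (_ : c2 * (2 * _) = nu ^+ 2 / sg ^+ 2 * up_sd_at S X0 m ^+ 2); last first.
    by rewrite /c2; field; rewrite gt_eqF.
  have u0 : 0 <= up_sd_at S X0 m by exact: sqrtr_ge0.
  apply: ler_pM; rewrite ?sqr_ge0//.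
  - by rewrite divr_ge0 ?sqr_ge0.
  - rewrite ler_pM2l ?exprn_gt0// lef_pV2 ?posrE ?exprn_gt0//.
    by apply: lerXn2r; rewrite ?nnegrE ?(ltW s_0) ?(ltW sg0).
  - by apply: lerXn2r; rewrite ?nnegrE// (le_trans u0).
rewrite mulrDr; lra.
Qed.

(** * The walk as a continuous function of its increments, and backward induction *)

Section path.
Variables (n : nat) (cm cs : nat -> R -> R).
Hypotheses (ccm : forall i, continuous (cm i)) (ccs : forall i, continuous (cs i)).
Hypothesis cs0 : forall i x, cs i x != 0.
Local Notation nu := ((Num.sqrt n%:R)^-1 : R).

(* [y i] is the value of the variable of index [i.+1]. *)
Fixpoint path_sum (y : nat -> R) (k : nat) : R :=
  if k is j.+1 then path_sum y j +
    nu * ((y j - cm j.+1 (path_sum y j)) / cs j.+1 (path_sum y j))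
  else 0.

Lemma eq_path_sum y z k : (forall i, (i < k)%N -> y i = z i) ->
  path_sum y k = path_sum z k.
Proof.
elim: k => //= k IH yz; rewrite IH ?yz// => i ik; exact/yz/ltnW.
Qed.

Lemma continuous_path_sum (T : topologicalType) (y : T -> nat -> R) k :
  (forall i, continuous (y ^~ i)) -> continuous (fun t => path_sum (y t) k).
Proof.
move=> cy; elim: k => [|k IH] t /=; first exact: cvg_cst.
have cc f : continuous f -> continuous (fun t => f (path_sum (y t) k)).
  by move=> cf z; apply: (@cvg_comp _ _ _ (fun t => path_sum (y t) k) f); [exact: IH|exact: cf].
apply: cvgD; first exact: IH.
apply: cvgM; first exact: cvg_cst.
apply: cvgM; first by apply: cvgB; [exact: cy|exact: cc].
by apply: cvgV; [exact: cs0|exact: cc].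
Qed.

(** Total in [i], with value 0 out of range, so that [path_sum] applies to row vectors of every
    length. *)
Definition entry m (v : 'rV[R]_m) (i : nat) : R :=
  oapp (fun j : 'I_m => v ord0 j) 0 (insub i).

Lemma entryE m (v : 'rV[R]_m) i (im : (i < m)%N) : entry v i = v ord0 (Ordinal im).
Proof. by rewrite /entry insubT. Qed.

Lemma continuous_entry m i : continuous (fun v : 'rV[R]_m => entry v i).
Proof.
rewrite /entry; case: insub => [j|] /=; first exact: coord_continuous.
by move=> v; apply: cst_continuous.
Qed.

Lemma entry_row_mxl m (v : 'rV[R]_m) (z : 'rV[R]_1) i : (i < m)%N ->
  entry (row_mx v z) i = entry v i.
Proof.
move=> im; rewrite (entryE _ im) (entryE _ (ltn_addr 1 im)).
by rewrite -[RHS](row_mxEl v z); congr (row_mx _ _ _ _); exact: val_inj.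
Qed.

Lemma entry_row_mxr m (v : 'rV[R]_m) (z : 'rV[R]_1) : 
  entry (row_mx v z) m = z ord0 ord0.
Proof.
have im : (m < m + 1)%N by rewrite addn1.
rewrite (entryE _ im) -[RHS](row_mxEr v z); congr (row_mx _ _ _ _).
by apply: val_inj; rewrite /= addn0.
Qed.

Variable X : nat -> Omega -> R.
Hypothesis hiid : iid_with_X0 S X.
Local Notation W w k := (path_sum (fun i => X i.+1 w) k).

Lemma entry_Xvec m w i : (i < m)%N -> entry (Xvec X m w) i = X i.+1 w.
Proof. by move=> im; rewrite (entryE _ im) mxE. Qed.

Lemma path_sum_Xvec m w : path_sum (entry (Xvec X m w)) m = W w m.
Proof. by apply: eq_path_sum => i im; exact: entry_Xvec. Qed.

Lemma path_sum_row_mx m (v : 'rV[R]_m) (z : R) :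
  path_sum (entry (row_mx v (\row_(_ < 1) z))) m.+1 =
  path_sum (entry v) m + nu * ((z - cm m.+1 (path_sum (entry v) m)) /
                                  cs m.+1 (path_sum (entry v) m)).
Proof.
rewrite /= entry_row_mxr mxE; set P := path_sum _ m; set Q := path_sum _ m.
by have -> : P = Q by apply: eq_path_sum => i im; exact: entry_row_mxl.
Qed.

Lemma bounded_continuous_path_sum (f : R -> R) m k : continuous f ->
  (forall x, 0 <= f x <= 1) ->
  bounded_continuous (fun v : 'rV[R]_m => f (path_sum (entry v) k)).
Proof.
move=> cf f01; split; first by apply: bounded_fun01 => v; exact: f01.
move=> v; apply: (@cvg_comp _ _ _ (fun v => path_sum (entry v) k) f); last exact: cf.
apply: continuous_path_sum => i; exact: continuous_entry.
Qed.

(** Independence applied to [f] of the walk as a function of the row vector. The inner expectation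
    depends on the past only through the current position, and [0 < m] because independence starts
    with the second variable. *)
Lemma path_sum_independent (f : R -> R) m : continuous f ->
  (forall x, 0 <= f x <= 1) -> (0 < m)%N ->
  let inner x := E (fun w => f (x + nu * ((X m.+1 w - cm m.+1 x) / cs m.+1 x))) in
  [/\ rvs S (fun w => f (W w m.+1)), rvs S (fun w => inner (W w m)) &
      E (fun w => f (W w m.+1)) = E (fun w => inner (W w m))].
Proof.
move=> cf f01 m0 inner.
pose psi (v : 'rV[R]_(m + 1)) := f (path_sum (entry v) m.+1).
have bpsi : bounded_continuous psi.
  exact: (@bounded_continuous_path_sum f (m + 1) m.+1 cf f01).
have e1 : (fun w => psi (row_mx (Xvec X m w) (\row_(_ < 1) X m.+1 w))) =
    (fun w => f (W w m.+1)).
  by apply/funext => w; rewrite /psi path_sum_row_mx path_sum_Xvec.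
have e2 : (fun w => E (fun w0 => psi (row_mx (Xvec X m w) (\row_(_ < 1) X m.+1 w0)))) =
    (fun w => inner (W w m)).
  apply/funext => w; congr E; apply/funext => w0.
  by rewrite /psi path_sum_row_mx path_sum_Xvec.
by rewrite -e1 -e2; exact: (hiid.1 m.+1 m0 psi bpsi).
Qed.

Lemma rvs_path_sum (f : R -> R) k : continuous f ->
  (forall x, 0 <= f x <= 1) -> (0 < k)%N -> rvs S (fun w => f (W w k)).
Proof.
move=> cf f01; case: k => [//|[_|k _]]; last by have [] := @path_sum_independent f k.+1 cf f01.
(* For one step, membership comes from the law of the first variable. *)
have b1 : bounded_continuous (fun y => f (path_sum (fun=> y) 1)).
  split; first by apply: bounded_fun01 => v; exact: f01.
  move=> v; apply: (@cvg_comp _ _ _ (fun v => path_sum (fun=> v) 1) f); last exact: cf.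
  by apply: (@continuous_path_sum R (fun y _ => y)) => i z; exact: cvg_id.
by have [] := hiid.2 1%N isT _ b1.
Qed.

(** The last variable is integrated first, and each one removed replaces [v j] by [v j.+1] at the
    cost [err j]. The induction runs over the number of steps already walked. *)
Lemma upexp_path_sum (v : nat -> R -> R) (err : nat -> R) : (0 < n)%N ->
  (forall j, continuous (v j)) -> (forall j x, 0 <= v j x <= 1) ->
  (forall i x, (1 <= i <= n)%N ->
    E (fun w => v (n - i)%N (x + nu * ((X i w - cm i x) / cs i x))) <=
    v (n - i).+1 x + err (n - i)%N) ->
  E (fun w => v 0%N (W w n)) <= v n 0 + \sum_(j < n) err j.
Proof.
move=> n0 cv v01 step.
suff H k : (k < n)%N -> E (fun w => v (n - k.+1)%N (W w k.+1)) <=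
    v n 0 + \sum_(n - k.+1 <= j < n) err j.
  have := H n.-1; rewrite prednK// subnn => /(_ (leqnn _)).
  by rewrite big_mkord.
elim: k => [|k IH] kn.
  (* The first step starts from the deterministic position 0. *)
  have := step 1%N 0; rewrite kn => /(_ isT).
  have n1 : (n - 1).+1 = n by rewrite subn1 prednK.
  have S1 : index_iota (n - 1) n = [:: n - 1]%N by rewrite /index_iota subKn.
  by rewrite n1 S1 big_seq1.
have [r1 r2 ->] := path_sum_independent (cv (n - k.+2)%N) (v01 _) (ltn0Sn k).
have kn' : (k.+1 < n)%N := kn.
have e1 : (n - k.+2).+1 = (n - k.+1)%N by rewrite subnS prednK// subn_gt0.
have rk := rvs_path_sum (cv (n - k.+1)%N) (v01 _) (ltn0Sn k).
apply: (@le_trans _ _ (E (fun w => v (n - k.+1)%N (W w k.+1) + err (n - k.+2)%N))).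
  apply: upexp_mono => //; first by apply: rvsD => //; exact: rvs_cst.
  by move=> w; have := step k.+2 (W w k.+1); rewrite kn e1; apply.
rewrite upexpDc//.
have lt_k : (n - k.+2 < n)%N by rewrite -{2}(subn0 n) ltn_sub2l.
rewrite big_ltn// e1.
by have := IH (ltnW kn); lra.
Qed.

(** Closes the feedback loop: the walk is first built by recursion from the feedback functions, and
    the controls evaluated along it reproduce that same walk. *)
Lemma Wsum_path_sum k w :
  Wsum X (fun i w => cm i (W w i.-1)) (fun i w => cs i (W w i.-1)) n k w = W w k.
Proof.
rewrite /Wsum; elim: k => [|k IH]; first by rewrite big_geq// mulr0.
by rewrite big_nat_recr//= mulrDr IH.
Qed.

End path.
End iteration.

(** * The Prokhorov bound *)

Section final.
Context {R : realType} {Omega : Type} (S : sublinear_space R Omega).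
Local Notation E := (upexp S).

Lemma up_mean_interval (X0 : Omega -> R) : rvs S X0 ->
  mean_interval S X0 (up_mean S X0).
Proof. by move=> hX; rewrite /mean_interval/= lexx andbT; exact: low_mean_le. Qed.

(** The inequality [t ^+ 3 >= 3/2 * t ^+ 2 - 1/2] for [t >= 0] replaces Jensen's: the upper
    expectation of its right side is at least 1, as the upper variance dominates the lower one used
    to normalize. *)
Lemma gamma3_ge1 (X0 : Omega -> R) : rvs S X0 -> rvs S (fun w => X0 w ^+ 2) ->
  0 < low_sd_at S X0 (up_mean S X0) -> (1 <= gamma3 S X0)%E.
Proof.
move=> hX hX2; set m := up_mean S X0 => l0.
apply: le_ereal_sup_tmp; eexists; first by exists m => //; exact: up_mean_interval.
apply: le_ereal_inf_tmp => _ [Y [rY YX] <-]; rewrite lee_fin.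
set l := low_sd_at S X0 m.
pose a := 3 / (2 * l ^+ 2).
have l2 : 0 < l ^+ 2 by rewrite exprn_gt0.
have a0 : 0 < a by rewrite divr_gt0// mulr_gt0.
have lu : l ^+ 2 <= up_sd_at S X0 m ^+ 2.
  have lu' : l <= up_sd_at S X0 m by exact: low_sd_at_le.
  by apply: lerXn2r; rewrite ?nnegrE ?sqrtr_ge0.
apply: (@le_trans _ _ (E (fun w => a * ((X0 w - m) ^+ 2 - l ^+ 2 / 3)))).
  rewrite upexp_centered_var// (ltW a0).
  apply: (@le_trans _ _ (a * (l ^+ 2 - l ^+ 2 / 3))).
    by rewrite le_eqVlt; apply/orP; left; apply/eqP; rewrite /a; field; rewrite gt_eqF.
  by rewrite ler_pM2l// lerD2r.
apply: upexp_mono => //.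
  by apply: rvsZ; apply: rvsD; [exact: rvs_centered_sqr|exact: rvs_cst].
move=> w; apply: le_trans (YX w).
set z := (X0 w - m) / l.
have -> : a * ((X0 w - m) ^+ 2 - l ^+ 2 / 3) = 3 / 2 * z ^+ 2 - 2^-1.
  by rewrite /a /z; field; rewrite gt_eqF.
rewrite -(real_normK (num_real z)); set t := `|z|.
have t0 : 0 <= t by exact: normr_ge0.
have : 0 <= (t - 1) ^+ 2 * (2 * t + 1).
  by apply: mulr_ge0; [exact: sqr_ge0|lra].
lra.
Qed.

(* The left-hand side is in fact below [0.71 * e]: the constant 12 leaves a margin. *)
Lemma error_budget (n e g nu T : R) : 0 < e -> e <= 1 -> 1 <= g -> 0 < nu ->
  nu ^+ 2 * n = 1 -> e ^+ 2 = 12 * g * nu ->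
  T <= n * (331 / 20 / e) + 187 / e ^+ 3 ->
  T * (nu ^+ 3 / 6 * (g + 1 / 10 + 7 / 4)) <= 9 / 10 * e.
Proof.
move=> e0 e1 g1 nu0 nun eg hT.
have g0 : 0 < g by lra.
have n3 : 0 < nu ^+ 3 by rewrite exprn_gt0.
have K0 : 0 <= nu ^+ 3 / 6 * (g + 1 / 10 + 7 / 4) by rewrite mulr_ge0 ?divr_ge0// ?ltW//; lra.
apply: le_trans (ler_wpM2r K0 hT) _.
have nuE : nu = e ^+ 2 / (12 * g) by rewrite eg; field; rewrite gt_eqF.
have T0 : 0 <= n * (331 / 20 / e) + 187 / e ^+ 3.
  have n0 : 0 <= n.
    have nu2 : 0 < nu ^+ 2 by rewrite exprn_gt0.
    by rewrite -(pmulr_rge0 _ nu2) nun.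
  apply: addr_ge0.
    by apply: mulr_ge0; [exact: n0|apply: divr_ge0; [lra|exact: ltW]].
  by apply: divr_ge0; [lra|rewrite exprn_ge0// ltW].
(* As [g >= 1], the additive constants are absorbed: [1 + 1/10 + 7/4 = 57/20]. *)
apply: (@le_trans _ _ ((n * (331 / 20 / e) + 187 / e ^+ 3) * (nu ^+ 3 / 6 * (57 / 20 * g)))).
  by apply: ler_wpM2l => //; apply: ler_wpM2l; [rewrite divr_ge0 // ltW|lra].
have -> : (n * (331 / 20 / e) + 187 / e ^+ 3) * (nu ^+ 3 / 6 * (57 / 20 * g)) =
    (nu ^+ 2 * n) * (331 / 20 / e) * ((nu * g) / 6 * (57 / 20)) +
    187 / e ^+ 3 * (nu ^+ 2 * (nu * g) / 6 * (57 / 20)).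
  by field; rewrite gt_eqF.
have -> : nu * g = e ^+ 2 / 12 by rewrite eg; field.
rewrite nun.
have nu2 : nu ^+ 2 <= e ^+ 4 / 144.
  have : nu <= e ^+ 2 / 12.
    rewrite nuE ler_pM2l ?exprn_gt0// lef_pV2 ?posrE ?mulr_gt0//; lra.
  move=> h; have := lerXn2r 2 (_ : nu \in Num.nneg) (_ : e ^+ 2 / 12 \in Num.nneg) h.
  rewrite !nnegrE (ltW nu0) divr_ge0 ?sqr_ge0// => /(_ isT isT) /le_trans; apply.
  by rewrite le_eqVlt; apply/orP; left; apply/eqP; field.
apply: (@le_trans _ _ (1 * (331 / 20 / e) * (e ^+ 2 / 12 / 6 * (57 / 20)) +
    187 / e ^+ 3 * (e ^+ 4 / 144 * (e ^+ 2 / 12) / 6 * (57 / 20)))).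
  rewrite lerD2l; apply: ler_wpM2l.
    by apply: divr_ge0; [lra|rewrite exprn_ge0// ltW].
  apply: ler_wpM2r; first lra.
  apply: ler_wpM2r; first by rewrite invr_ge0.
  by apply: ler_wpM2r => //; apply: divr_ge0 => //; exact: sqr_ge0.
have -> : 1 * (331 / 20 / e) * (e ^+ 2 / 12 / 6 * (57 / 20)) +
    187 / e ^+ 3 * (e ^+ 4 / 144 * (e ^+ 2 / 12) / 6 * (57 / 20)) =
    331 / 20 * (57 / 20) / 72 * e + 187 / 144 * (57 / 20) / 72 * e ^+ 3.
  by field; rewrite gt_eqF.
have : e ^+ 3 <= e.
  rewrite -[leRHS]mulr1 exprS ler_pM2l//; apply: exprn_ile1 => //; exact: ltW.
lra.
Qed.

Section gap.
Variable X : nat -> Omega -> R.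
Hypotheses (hiid : iid_with_X0 S X) (hX0 : rvs S (X 0%N)).
Hypothesis hX0sq : rvs S (fun w => X 0%N w ^+ 2).
Hypothesis hlow : (0 < low_sd S (X 0%N))%E.
Hypothesis hup : (up_sd S (X 0%N) < +oo)%E.
Variable n : nat.
Hypothesis hn : (0 < n)%N.
Variable g : R.
Hypothesis hg : gamma3 S (X 0%N) = g%:E.
Local Notation X0 := (X 0%N).
Local Notation nu := ((Num.sqrt n%:R)^-1 : R).

Lemma low_sd_fin : exists2 s : R, 0 < s &
  forall m, mean_interval S X0 m -> s <= low_sd_at S X0 m.
Proof.
have h m : mean_interval S X0 m -> (low_sd S X0 <= (low_sd_at S X0 m)%:E)%E.
  by move=> mI; apply: ereal_inf_lbound; exists m.
move: hlow h; rewrite /low_sd; case: (ereal_inf _) => [s| |] //.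
- by rewrite lte_fin => s0 h; exists s => // m /h; rewrite lee_fin.
- by move=> _ /(_ _ (up_mean_interval hX0)).
Qed.

Lemma up_sd_fin : exists s : R,
  forall m, mean_interval S X0 m -> up_sd_at S X0 m <= s.
Proof.
have h m : mean_interval S X0 m -> ((up_sd_at S X0 m)%:E <= up_sd S X0)%E.
  by move=> mI; apply: ereal_sup_ubound; exists m.
move: hup h; rewrite /up_sd; case: (ereal_sup _) => [s| |] //.
- by move=> _ h; exists s => m /h; rewrite lee_fin.
- by move=> _ /(_ _ (up_mean_interval hX0)).
Qed.

(** The infimum defining the extended expectation may fail to be attained; the slack 1/10 buys an
    actual majorant in the space. *)
Lemma third_moment_majorant m : mean_interval S X0 m ->
  exists Y, [/\ rvs S Y,
    forall w, `|(X0 w - m) / low_sd_at S X0 m| ^+ 3 <= Y w & E Y <= g + 1 / 10].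
Proof.
move=> mI.
have : (upexp_ext S (fun w => `|(X0 w - m) / low_sd_at S X0 m| ^+ 3)%R < (g + 1 / 10)%:E)%E.
  apply: (@le_lt_trans _ _ (gamma3 S X0)); last by rewrite hg lte_fin; lra.
  by apply: ereal_sup_ubound; exists m.
move=> /ereal_inf_lt[_ [Y [rY YX] <-]]; rewrite lte_fin => EY.
by exists Y; split => //; exact: ltW.
Qed.

(** The real number [x] is [v n 0], the Gaussian mean of the cutoff. It separates the walk estimate
    from the comparison with the normal law. *)
Lemma upper_prob_le (A : set R) (e : R) : 0 < e -> e ^+ 2 = 12 * g * nu ->
  exists2 c, controls S X n c &
    exists2 x : R, (upper_prob S X n (Wsum X c.1 c.2 n n) A <= (x + e)%:E)%E &
      0 <= x /\ (x%:E <= normal_prob 0 1 (enlargement A e))%E.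
Proof.
move=> e0 eg.
have [v [p [q [v01 vc T step [vA vn]]]]] := smoothing_family A e0 hn.
have [s s0 sl] := low_sd_fin; have [sU su] := up_sd_fin.
have sr0 : 0 < Num.sqrt n%:R :> R by rewrite sqrtr_gt0 ltr0n.
have nu0 : 0 < nu by rewrite invr_gt0.
have nu2 : nu ^+ 2 = n%:R^-1 by rewrite exprVn sqr_sqrtr// ler0n.
pose K := nu / s * (up_mean S X0 - low_mean S X0) + nu ^+ 2 / s ^+ 2 * sU ^+ 2.
have K0 : 0 <= K.
  apply: addr_ge0; apply: mulr_ge0; rewrite ?sqr_ge0//.
  - by rewrite divr_ge0// ltW.
  - by rewrite subr_ge0 low_mean_le.
  - by rewrite divr_ge0// sqr_ge0.
have nK : 0 <= n%:R * K by rewrite mulr_ge0.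
have nK1 : 0 < n%:R * K + 1 by rewrite ltr_wpDl.
(* The switching width is chosen so that the [n] steps together cost at most [e / 10]; the remaining
   [9/10 * e] is left for [error_budget]. *)
pose d := e / 10 / (n%:R * K + 1).
have d0 : 0 < d by rewrite !divr_gt0.
have dK : n%:R * (d * K) <= e / 10.
  rewrite /d (_ : _ * _ = e / 10 * (n%:R * K / (n%:R * K + 1))); last first.
    by field; rewrite gt_eqF.
  rewrite ler_piMr ?divr_ge0 ?(ltW e0)// ler_pdivrMr// mul1r lerDl//.
(* After step [i], [n - i] steps remain, so the feedback reads the derivatives of [v (n - i)]. *)
pose cm i x := switch_mean S X0 d (p (n - i)%N x).
pose cs i x := switch_sd S X0 d (cm i x) (q (n - i)%N x).
have cmI i x : mean_interval S X0 (cm i x) by exact: switch_mean_itv.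
have l0 i x : 0 < low_sd_at S X0 (cm i x) by exact: lt_le_trans (sl _ (cmI i x)).
have csI i x : low_sd_at S X0 (cm i x) <= cs i x <= up_sd_at S X0 (cm i x).
  exact: switch_sd_itv.
have cs0 i x : cs i x != 0.
  by rewrite gt_eqF//; case/andP: (csI i x) => h _; exact: lt_le_trans h.
have ccm i : continuous (cm i).
  have [_ cp _] := vc (n - i)%N.
  move=> x; apply: cvgD; first exact: cvg_cst.
  apply: cvgM; last exact: cvg_cst.
  apply: (@cvg_comp _ _ _ (p (n - i)%N) (switch d)); first exact: cp.
  exact: switch_continuous.
have ccs i : continuous (cs i).
  have [_ _ cq] := vc (n - i)%N.
  have cl : continuous (fun x => low_sd_at S X0 (cm i x)).
    move=> x; apply: (@cvg_comp _ _ _ (cm i) (low_sd_at S X0)); first exact: ccm.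
    exact: low_sd_at_continuous.
  have cU : continuous (fun x => up_sd_at S X0 (cm i x)).
    move=> x; apply: (@cvg_comp _ _ _ (cm i) (up_sd_at S X0)); first exact: ccm.
    exact: up_sd_at_continuous.
  move=> x; apply: cvgD; first exact: cl.
  apply: cvgM; last by apply: cvgB; [exact: cU|exact: cl].
  apply: (@cvg_comp _ _ _ (q (n - i)%N) (switch d)); first exact: cq.
  exact: switch_continuous.
pose W k w := path_sum n cm cs (fun i => X i.+1 w) k.
have WE k w : Wsum X (fun i w => cm i (W i.-1 w)) (fun i w => cs i (W i.-1 w)) n k w = W k w.
  exact: Wsum_path_sum.
exists (fun i w => cm i (W i.-1 w), fun i w => cs i (W i.-1 w)).
  move=> i /andP[i1 ni]; split => /=.
  - by exists (cm i) => // w; rewrite WE.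
  - by exists (cs i) => // w; rewrite WE.
  - by move=> w; exact: cmI.
  - move=> w; have /andP[h1 h2] := csI i (W i.-1 w); split => //.
      by apply: ereal_inf_lbound; exists (cm i (W i.-1 w)).
    by apply: ereal_sup_ubound; exists (cm i (W i.-1 w)).
have cv j : continuous (v j) by have [] := vc j.
have rW := rvs_path_sum n ccm ccs cs0 hiid (cv 0%N) (v01 0%N) hn.
exists (v n 0); last by split => //; have /andP[] := v01 n 0.
(* The function [v 0] of the walk majorizes the indicator of [A], hence competes in the infimum
   defining the upper probability. *)
apply: ge_ereal_inf; exists (E (fun w => v 0%N (W n w)))%:E.
  exists (fun z => v 0%N (path_sum n cm cs (entry z) n)).
    split => [w|] /=; last first.
      by rewrite (_ : _ \o _ = (fun w => v 0%N (W n w)))//; apply/funext => w /=;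
        rewrite path_sum_Xvec.
    rewrite path_sum_Xvec WE -/(W n w) indicE; case: (boolP (_ \in A)) => [|_].
      by rewrite inE => /vA ->.
    by have /andP[] := v01 0%N (W n w).
  by congr (E _)%:E; apply/funext => w /=; rewrite path_sum_Xvec.
(* For [e >= 1] the bound is trivial, as [v 0 <= 1]. *)
rewrite lee_fin; have [e1|/ltW e1] := leP e 1; last first.
  rewrite -[leLHS]mul1r; apply: (@le_trans _ _ 1).
    rewrite mul1r -(upexp_cst S 1); apply: upexp_mono => //; first exact: rvs_cst.
    by move=> w; have /andP[] := v01 0%N (W n w).
  by rewrite (le_trans e1)// lerDr; have /andP[] := v01 n 0.
(* The part [g + 1/10] is the cubic remainder of the walk, [7/4] that of the Gaussian step, and
   [d * K] the switching cost. *)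
pose err j := third_bound e n j * (nu ^+ 3 / 6 * (g + 1 / 10 + 7 / 4)) + d * K.
apply: le_trans (upexp_path_sum ccm ccs cs0 hiid (err := err) hn cv v01 _) _.
  move=> i x /andP[i1 ni].
  have [Y [rY YX EY]] := third_moment_majorant (cmI i x).
  have jn : (n - i < n)%N by rewrite -subn_gt0 subKn.
  have L0 := third_bound_ge0 n (n - i)%N e0.
  apply: le_trans (switch_step hX0 hX0sq (hiid.2 i i1) rY YX (v01 _) (cv _)
    (T _ jn) L0 d0 nu0 s0 (sl _ (cmI i x)) (su _ (cmI i x)) erefl erefl) _.
  have := step (n - i)%N x; rewrite -nu2 -/K.
  have LY : third_bound e n (n - i) / 6 * nu ^+ 3 * E Y <=
      third_bound e n (n - i) / 6 * nu ^+ 3 * (g + 1 / 10).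
    apply: ler_wpM2l EY; apply: mulr_ge0; first exact: divr_ge0.
    by rewrite exprn_ge0// ltW.
  by rewrite /err; lra.
have sdK : \sum_(j < n) d * K = n%:R * (d * K) by rewrite sumr_const card_ord mulr_natl.
rewrite lerD2l /err big_split/= -mulr_suml sdK.
have g1 : 1 <= g.
  by rewrite -lee_fin -hg gamma3_ge1// (lt_le_trans s0)// sl//; exact: up_mean_interval.
have nun : nu ^+ 2 * n%:R = 1 by rewrite nu2 mulVf// gt_eqF// ltr0n.
have := error_budget e0 e1 g1 nu0 nun eg (sum_third_bound e0 hn).
lra.
Qed.
End gap.
End final.

Unset Implicit Arguments.

Theorem mainTheorem5 (R : realType) (Omega : Type)
    (S : sublinear_space R Omega) (X : nat -> Omega -> R)
    (hiid : iid_with_X0 S X)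
    (hX0 : rvs S (X 0%N))
    (hX0sq : rvs S (fun w => X 0%N w ^+ 2))
    (hlow : (0 < low_sd S (X 0%N))%E)
    (hlowup : (low_sd S (X 0%N) <= up_sd S (X 0%N))%E)
    (hup : (up_sd S (X 0%N) < +oo)%E)
    (n : nat) (hn : (1 <= n)%N)
    (d : measure_display) (T : measurableType d) (P : probability T R)
    (Z : {RV P >-> R})
    (hZ : forall B : set R, measurable B ->
            distribution P Z B = normal_prob 0 1 B) :
  (prokhorov_dist S X n Z
     <= sqrte ((C5 R)%:E * gamma3 S (X 0%N)) * ((n%:R `^ 4^-1)^-1)%:E)%E.
Proof.
have n0 : 0 < n%:R :> R by rewrite ltr0n.
have q0 : 0 < n%:R `^ 4^-1 :> R by rewrite powR_gt0.
have l0 : 0 < low_sd_at S (X 0%N) (up_mean S (X 0%N)).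
  by have [s s0 sl] := low_sd_fin hX0 hlow; rewrite (lt_le_trans s0)// sl//; exact: up_mean_interval.
have := gamma3_ge1 hX0 hX0sq l0.
(* If [gamma3] is infinite so is the right-hand side; the value [-oo] is excluded by the lower bound
   1. *)
case hg : (gamma3 S (X 0%N)) => [g| |] //; last first.
  move=> _; rewrite gt0_muley ?lte_fin ?/C5 ?ltr0n//=.
  by rewrite gt0_mulye ?lte_fin ?invr_gt0// leey.
rewrite lee_fin => g1; have g0 : 0 < g by lra.
rewrite -EFinM /= -?EFinM; set e := Num.sqrt _ * _.
have e0 : 0 < e by rewrite mulr_gt0 ?invr_gt0// sqrtr_gt0 mulr_gt0// ltr0n.
have q2 : (n%:R `^ 4^-1) ^+ 2 = Num.sqrt n%:R :> R.
  rewrite -powR_mulrn ?powR_ge0// -powRrM -powR12_sqrt ?ler0n//.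
  by congr (_ `^ _); field.
have eg : e ^+ 2 = 12 * g * (Num.sqrt n%:R)^-1.
  by rewrite /e exprMn exprVn q2 sqr_sqrtr// mulr_ge0 ?ler0n// ltW.
(* The radius [e] itself is admissible in the infimum defining the distance. *)
apply: ereal_inf_lbound; exists e => //; split => //.
apply: ge_ereal_sup => _ [A _ <-].
have [c cc [x xe [x0 xP]]] := upper_prob_le hiid hX0 hX0sq hlow hup hn hg A e0 eg.
(* The enlargement is open for every [A], so the law of [Z] can be evaluated on it. *)
have PE : P (Z @^-1` enlargement A e) = normal_prob 0 1 (enlargement A e).
  by rewrite -hZ//; exact: measurable_enlargement.
rewrite /prokhorov_gap PE.
have fP : normal_prob 0 1 (enlargement A e) \is a fin_num.
  have mB := measurable_enlargement A e.
  by rewrite -hZ//; apply: fin_num_measure.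
rewrite leeBlDr//; apply: (@le_trans _ _ (upper_prob S X n (Wsum X c.1 c.2 n n) A)).
  by apply: ereal_inf_lbound; exists c.
by apply: le_trans xe _; rewrite EFinD addeC leeD2l.
Qed.
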